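(* Let $G$ be a compact group and $\iota:H\hookrightarrow G$ an embedding of compact groups. Then $\iota$ is an equalizer in the category of compact groups; that is, there exist a compact group $K$ and continuous homomorphisms $\varphi_0,\varphi_1:G\to K$ such that $\iota$ is an equalizer of the pair $(\varphi_0,\varphi_1)$ in the category of compact groups.
   Context: The category of compact groups has compact Hausdorff topological groups as objects and continuous group homomorphisms as morphisms. An embedding of compact groups is an injective continuous homomorphism (automatically a homeomorphism onto a closed subgroup). *)

(* Defs.v *)
From HB Require Import structures.
From mathcomp Require Import all_boot.
From mathcomp Require Import boolp classical_sets functions topology.

Set Implicit Arguments.
Unset Strict Implicit.
Unset Printing Implicit Defensive.

Local Open Scope group_scope.
Local Open Scope classical_set_scope.

HB.structure Definition PreTopologicalGroup :=
  {G of Topological G & Group G}.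

HB.mixin Record PreTopologicalGroup_isTopologicalGroup G
    & PreTopologicalGroup G := {
  mulg_continuous : continuous (fun x : G * G => x.1 * x.2);
  invg_continuous : continuous (fun x : G => x^-1)
}.

#[short(type="topologicalGroupType")]
HB.structure Definition TopologicalGroup :=
  {G of PreTopologicalGroup G & PreTopologicalGroup_isTopologicalGroup G}.

HB.mixin Record Topological_isCompactHausdorff T & Topological T := {
  compact_setT : compact [set: T];
  hausdorff_setT : hausdorff_space T
}.

#[short(type="compactGroupType")]
HB.structure Definition CompactGroup :=
  {G of TopologicalGroup G & Topological_isCompactHausdorff G}.

#[short(type="compactGroupHom")]
HB.structure Definition CompactGroupHom (G H : compactGroupType) :=
  {f of @Continuous G H f & @UMagmaMorphism G H f}.

Lemma compactGroupHomP (G H : compactGroupType) (f g : compactGroupHom G H) :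
  f = g <-> f = g :> (G -> H).
Proof.
case: f g => [f [[cf] [mf] [uf]]] [g [[cg] [mg] [ug]]] /=; split=> [[]//|fg].
subst g; have -> := Prop_irrelevance cg cf.
by have -> := Prop_irrelevance mg mf; have -> := Prop_irrelevance ug uf.
Qed.

(* Compact groups and their morphisms form a category: identities and composites
   of morphisms are morphisms. *)
HB.instance Definition _ (G : compactGroupType) :=
  UMagmaMorphism.on (@idfun G).

HB.instance Definition _ (G H K : compactGroupType)
    (g : compactGroupHom H K) (f : compactGroupHom G H) :=
  UMagmaMorphism.on (g \o f).

Definition is_equalizer (E G K : compactGroupType) (iota : compactGroupHom E G)
    (phi0 phi1 : compactGroupHom G K) : Prop :=
  phi0 \o iota = phi1 \o iota :> compactGroupHom E K /\
  forall (L : compactGroupType) (f : compactGroupHom L G),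
    phi0 \o f = phi1 \o f :> compactGroupHom L K ->
    exists! u : compactGroupHom L E, iota \o u = f :> compactGroupHom L G.

(* Main.v *)
(* A closed subgroup is cut out by reflections, in the style of the Peter-Weyl
   theorem. If [x] lies outside the image of [H], a convolution operator on [G]
   with symmetric kernel has an eigenvector [e] for a nonzero eigenvalue that is
   fixed by left translation by [H] but not by [x], and whose invariant mean is
   nonzero. The L2 unit ball of its eigenspace is a compact metric space on which
   [G] acts by isometries. The isometry group of this ball is compact and contains
   the reflection [c] in [e]; the action and its conjugate by [c] agree exactly at
   the elements of [G] that fix [e], hence on [H] and not at [x]. A product over
   all [x] gives the required pair.
   The invariant mean is obtained by von Neumann's averaging of translates, and
   the eigenvector comes from the extremal problem for |T f| / |f|, with Tychonoff
   and equicontinuity replacing the completeness of L2. *)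
From HB Require Import structures.
From mathcomp Require Import all_boot all_order all_algebra.
From mathcomp Require Import boolp classical_sets functions reals topology.
From mathcomp Require Import normedtype lra ring Rstruct.
Require Import Defs.
Set Implicit Arguments.
Unset Strict Implicit.
Unset Printing Implicit Defensive.
Import Order.TTheory GRing.Theory Num.Theory.
Import numFieldNormedType.Exports.
Local Open Scope classical_set_scope.
Local Open Scope ring_scope.

(** * Averages of translates *)

(** All functions are continuous and the only integral is an invariant positive functional, so L2
    limits may fail to exist. Each limit is therefore taken in a bounded equicontinuous family,
    where it is uniform; such a family comes from applying a convolution or from imposing the
    modulus of continuity of a fixed function. Convolution on the right commutes with left
    translation, so eigenspaces carry an action of [G], functions fixed by [H] stay fixed by [H],
    and a symmetric kernel also preserves orthogonality to fixed functions. This allows the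
    eigenvector to be sought among [H]-fixed functions orthogonal to everything fixed by both [H]
    and [x]. A reflection in [e] sees only the line through [e]: it also commutes with an element
    sending [e] to [- e]. The nonzero mean is there to exclude that sign. *)

Lemma continuous_pair (X Y Z : topologicalType) (f : X -> Y) (g : X -> Z) :
  continuous f -> continuous g -> continuous (fun x => (f x, g x)).
Proof. by move=> cf cg x; apply: cvg_pair; [exact: cf|exact: cg]. Qed.

Lemma fst_continuous (X Y : topologicalType) : continuous (@fst X Y).
Proof. by move=> x; exact: cvg_fst. Qed.

Lemma snd_continuous (X Y : topologicalType) : continuous (@snd X Y).
Proof. by move=> x; exact: cvg_snd. Qed.

Lemma continuous_compose (X Y Z : topologicalType) (g : Y -> Z) (f : X -> Y) :
  continuous g -> continuous f -> continuous (fun x => g (f x)).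
Proof. by move=> cg cf x; apply: continuous_comp; [exact: cf|exact: cg]. Qed.

Section GroupContinuity.
Context {G : topologicalGroupType} {X : topologicalType}.
Implicit Types a b : X -> G.

Lemma continuous_mulg a b : continuous a -> continuous b ->
  continuous (fun x => (a x * b x)%g).
Proof.
move=> ca cb; apply: (@continuous_compose _ _ _ (fun p => (p.1 * p.2)%g)
  (fun x => (a x, b x))); first exact: mulg_continuous.
exact: continuous_pair.
Qed.

Lemma continuous_invg a : continuous a -> continuous (fun x => (a x)^-1%g).
Proof. exact/continuous_compose/invg_continuous. Qed.

End GroupContinuity.

Section UniformContinuity.
Context {R : realType} {G : compactGroupType}.

(** A tube lemma: continuity gives a product neighbourhood of each [(x0, g)], and compactness of [G]
    in its near-covering form makes one neighbourhood of [x0] serve all [g]. *)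
Lemma near_uniformly (X : topologicalType) (F : X * G -> R) (x0 : X) (e : R) :
  continuous F -> 0 < e ->
  \forall x \near x0, forall g, `|F (x, g) - F (x0, g)| <= e.
Proof.
move=> cF e0.
have /compact_near_coveringP/(_ X (nbhs x0)
  (fun x g => `|F (x, g) - F (x0, g)| <= e) _) cov := @compact_setT G.
suff /cov : forall g : G, setT g ->
    \forall g' \near g & x \near x0, `|F (x, g') - F (x0, g')| <= e.
  by apply: filterS => x h g; exact: h.
move=> g _; have e2 : 0 < e / 2 by lra.
have /cvgrPdist_le /(_ _ e2) [[A B] /= [nA nB] AB] := cF (x0, g).
exists (B, A) => //= -[g' x'] /= [Bg' Ax'].
have := AB (x', g') (conj Ax' Bg').
have := AB (x0, g') (conj (nbhs_singleton nA) Bg').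
rewrite /= => h1 h2.
rewrite (le_trans (ler_distD (F (x0, g)) _ _))// (splitr e) lerD// distrC//.
Qed.

(** A finite subcover is extracted from the near-covering form of compactness by taking as index
    filter the lists ordered by inclusion: a point near [x] is served by any list containing [x]. *)
Lemma translates_cover (U : set G) : nbhs (1%g : G) U ->
  exists l : seq G, forall z, exists2 g, g \in l & U (g^-1 * z)%g.
Proof.
move=> nU; pose F := filter_from [set: seq G]
   (fun l0 => [set l : seq G | {subset l0 <= l}]).
have FF : Filter F.
  apply: filter_from_filter; first by exists [::].
  move=> l1 l2 _ _; exists (l1 ++ l2) => // l /= s.
  by split=> x xl; apply: s; rewrite mem_cat xl ?orbT.
have /compact_near_coveringP/(_ _ F
  (fun l z => exists2 g, g \in l & U (g^-1 * z)%g) FF) cov := @compact_setT G.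
suff /cov : forall x : G, setT x ->
    \forall z \near x & l \near F, exists2 g, g \in l & U (g^-1 * z)%g.
  by case=> l _ /(_ l (fun _ => id)) H; exists l => z; exact: H.
move=> x _.
have nV : nbhs x [set z | U (x^-1 * z)%g].
  have /(_ x) c : continuous (fun z : G => (x^-1 * z)%g).
    by apply: continuous_mulg => z; [exact: cvg_cst|exact: cvg_id].
  by apply: c; rewrite mulVg.
exists ([set z | U (x^-1 * z)%g], [set l : seq G | {subset [:: x] <= l}]).
  by split=> //; exists [:: x].
move=> [z l] /= [Uz s]; exists x => //; apply: s; exact: mem_head.
Qed.

Lemma continuous_bounded (f : G -> R) : continuous f ->
  exists c, forall y, `|f y| <= c.
Proof.
move=> cf; have [B [Br BP]] : bounded_set (f @` setT).
  apply: compact_bounded; apply: continuous_compact; last exact: compact_setT.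
  exact: continuous_subspaceT.
exists (B + 1) => y; apply: (BP (B + 1)); first by rewrite ltrDl.
by exists y.
Qed.

End UniformContinuity.

Lemma lel_addgt0 (R : realFieldType) (x y C : R) : 0 < C ->
  (forall e, 0 < e -> x <= y + C * e) -> x <= y.
Proof.
move=> C0 h; apply/ler_addgt0Pr => e e0.
by have := h (e / C) (divr_gt0 e0 C0); rewrite mulrCA divff ?gt_eqF// mulr1.
Qed.

Section Averages.
Context {R : realType} {G : compactGroupType}.
Implicit Types (f g : G -> R) (S T : seq G).

(** Division by zero makes the average over the empty list 0, hence the hypotheses [S != [::]] later
    on. Repetitions in [S] act as weights. *)
Definition lavg S f : G -> R :=
  fun y => (\sum_(s <- S) f (s * y)%g) / (size S)%:R.
Definition ravg T f : G -> R :=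
  fun y => (\sum_(t <- T) f (y * t)%g) / (size T)%:R.

Lemma lavgD S f g y : lavg S (fun y => f y + g y) y = lavg S f y + lavg S g y.
Proof. by rewrite /lavg big_split mulrDl. Qed.

Lemma lavgZ S a f y : lavg S (fun y => a * f y) y = a * lavg S f y.
Proof. by rewrite /lavg -mulr_sumr mulrA. Qed.

Lemma lavg_comp S T f :
  lavg S (lavg T f) = lavg [seq (t * s)%g | s <- S, t <- T] f.
Proof.
apply/funext => y; rewrite /lavg size_allpairs big_allpairs_dep/=.
rewrite -mulr_suml -mulrA -invfM -natrM mulnC; congr (_ / _).
by apply: eq_bigr => s _; apply: eq_bigr => t _; rewrite mulgA.
Qed.

Lemma lavg_ravg S T f : lavg S (ravg T f) = ravg T (lavg S f).
Proof.
apply/funext => y; rewrite /lavg /ravg -!mulr_suml exchange_big/= mulrAC.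
congr (_ / _ / _); apply: eq_bigr => t _; apply: eq_bigr => s _.
by rewrite mulgA.
Qed.

Lemma lavg_le S f c : S != [::] -> (forall y, f y <= c) ->
  forall y, lavg S f y <= c.
Proof.
move=> S0 fc y; rewrite ler_pdivrMr; last by rewrite ltr0n lt0n size_eq0.
rewrite mulr_natr -[in leRHS](count_predT S) -iter_addr_0 -big_const_seq.
exact: ler_sum.
Qed.

Lemma lavg_ge S f c : S != [::] -> (forall y, c <= f y) ->
  forall y, c <= lavg S f y.
Proof.
move=> S0 fc y; rewrite -lerN2 -[leLHS]mulN1r -lavgZ.
by apply: lavg_le => // z; rewrite mulN1r lerN2.
Qed.

Lemma lavg_dist S f c e : S != [::] -> (forall y, `|f y - c| <= e) ->
  forall y, `|lavg S f y - c| <= e.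
Proof.
move=> S0 fc y; rewrite ler_distl lavg_ge ?lavg_le// => z;
by have := fc z; rewrite ler_distl => /andP[].
Qed.

(** Left averages commute with right translation. This is what allows averaging to be repeated with
    one and the same finite list. *)
Lemma lavg_right_modulus S f w e : S != [::] ->
  (forall y, `|f (y * w)%g - f y| <= e) ->
  forall y, `|lavg S f (y * w)%g - lavg S f y| <= e.
Proof.
move=> S0 fw y.
have := @lavg_dist S (fun y => f (y * w)%g + -1 * f y) 0 e S0.
move=> /(_ _ y); rewrite lavgD lavgZ mulN1r subr0.
have -> : lavg S (fun y => f (y * w)%g) y = lavg S f (y * w)%g.
  by rewrite /lavg; under eq_bigr do rewrite -mulgA.
by apply=> z; rewrite subr0 mulN1r.
Qed.

Definition mean_value f (c : R) := forall e : R, 0 < e ->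
  exists2 S, S != [::] & forall y, `|lavg S f y - c| <= e.

(* A point where [f] is within [e] of its lower bound has a neighbourhood where
   [f] is within [2 e] of it; averaging over translates that carry every point
   into that neighbourhood lowers the upper bound by a fixed amount. *)
Lemma lavg_osc f (e : R) : continuous f -> 0 < e ->
  exists2 S, S != [::] &
    exists c, forall y, c <= lavg S f y <= c + 3 * e.
Proof.
move=> cf e0; pose F (p : G * G) := f (p.2 * p.1)%g.
have cF : continuous F.
  move=> p; apply: continuous_comp; last exact: cf.
  by apply: continuous_mulg => q; [exact: cvg_snd|exact: cvg_fst].
have [l lP] := translates_cover (near_uniformly (1%g : G) cF e0).
have {lP}lP z : exists2 g, g \in l & forall y,
  `|f (y * (g^-1 * z))%g - f y| <= e.
  by have [g gl gP] := lP z; exists g => // y; have := gP y; rewrite /F/= mulg1.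
have l0 : l != [::] by case: (lP 1%g) => g; case: (l).
have n0 : 0 < (size l)%:R :> R by rewrite ltr0n lt0n size_eq0.
(* [k] counts the remaining steps: each one, be it an average or a better lower bound, shrinks the
   gap [M - m] by at least [e / size l], until it is at most [3 * e]. *)
suff shrink k (h : G -> R) (m M : R) :
    (forall z, exists2 g, g \in l & forall y,
      `|h (y * (g^-1 * z))%g - h y| <= e) ->
    (forall y, m <= h y <= M) -> M - m <= 3 * e + k%:R * (e / (size l)%:R) ->
    exists2 S, S != [::] & exists c, forall y, c <= lavg S h y <= c + 3 * e.
  have [b bP] := continuous_bounded cf.
  have d0 : 0 < e / (size l)%:R by rewrite divr_gt0.
  have [k kP] : exists k, b - (- b) <= k%:R * (e / (size l)%:R).
    exists (Num.truncn ((b - - b) / (e / (size l)%:R))).+1.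
    by rewrite -ler_pdivrMr// ltW// truncnS_gt.
  apply: (shrink k f (- b) b lP); last by lra.
  by move=> y; have := bP y; rewrite ler_norml.
elim: k h m M => [|k IH] h m M hl hmM.
  rewrite mul0r addr0 => Mm; exists [:: 1%g] => //; exists m => y.
  rewrite /lavg big_seq1 divr1 mul1g; have := hmM y; lra.
rewrite -[k.+1%:R]natr1 [(_ + 1) * _]mulrDl mul1r => Mm.
have [Mm3|Mm3] := leP (M - m) (3 * e).
  by apply: (IH h m M hl hmM);
    rewrite (le_trans Mm3)// lerDl mulr_ge0// divr_ge0// ltW.
have [[y0 hy0]|] := pselect (exists y0, h y0 < m + e); last first.
  move=> /forallNP hm; apply: (IH h (m + e) M hl).
    by move=> y; have /negP := hm y; have := hmM y; rewrite -leNgt; lra.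
  have : e / (size l)%:R <= e.
    by rewrite ler_pdivrMr// ler_pMr// ler1n lt0n size_eq0.
  lra.
pose S := [seq (y0 * a^-1)%g | a <- l].
have S0 : S != [::] by rewrite /S; case: (l) l0.
(* Of the [size l] terms at [y], the one landing near [y0] is at most [m + 2 * e] and the others at
   most [M]. As [M - m > 3 * e], the upper bound drops by more than [e / size l]. *)
have [|y||T T0 [c cP]] := IH (lavg S h) m (M - (M - m - 2 * e) / (size l)%:R).
- move=> z; have [g gl gP] := hl z; exists g => //.
  exact: lavg_right_modulus.
- rewrite lavg_ge//=; last by move=> z; case/andP: (hmM z).
  rewrite ler_pdivrMr ?size_map// mulrBl divfK ?gt_eqF// big_map.
  have [g gl gP] := hl y; rewrite (big_rem g)//= -mulgA.
  have := gP y0; rewrite ler_distl => /andP[_ hg].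
  have : \sum_(a <- rem g l) h (y0 * a^-1 * y)%g <= M * ((size l)%:R - 1).
    have -> : (size l)%:R - 1 = (size (rem g l))%:R :> R.
      by rewrite size_rem// -subn1 natrB// lt0n size_eq0.
    rewrite mulr_natr -[in leRHS](count_predT (rem g l)) -iter_addr_0.
    by rewrite -big_const_seq ler_sum// => z _;
      case/andP: (hmM (y0 * z^-1 * y)%g).
  lra.
- have : e / (size l)%:R <= (M - m - 2 * e) / (size l)%:R.
    by rewrite ler_pM2r ?invr_gt0//; lra.
  lra.
rewrite lavg_comp in cP; exists [seq (t * s)%g | s <- T, t <- S];
  last by exists c.
by rewrite -size_eq0 size_allpairs muln_eq0 !size_eq0 negb_or T0.
Qed.

End Averages.

(** * The invariant mean *)

Section ContinuousOperations.
Context {R : realType} {X : topologicalType}.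
Implicit Types f g : X -> R.

Lemma continuous_addf f g : continuous f -> continuous g ->
  continuous (fun x => f x + g x).
Proof. by move=> cf cg x; apply: cvgD; [exact: cf|exact: cg]. Qed.

Lemma continuous_mulf f g : continuous f -> continuous g ->
  continuous (fun x => f x * g x).
Proof. by move=> cf cg x; apply: cvgM; [exact: cf|exact: cg]. Qed.

Lemma continuous_cstf (a : R) : continuous (fun _ : X => a).
Proof. by move=> x; exact: cvg_cst. Qed.

Lemma continuous_scalef (a : R) f : continuous f ->
  continuous (fun x => a * f x).
Proof. exact/continuous_mulf/continuous_cstf. Qed.

End ContinuousOperations.

Section Mean.
Context {R : realType} {G : compactGroupType}.
Implicit Types (f g : G -> R) (S T : seq G).

Lemma continuous_translate f a b : continuous f ->
  continuous (fun y => f (a * y * b)%g).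
Proof.
move=> cf; apply: continuous_compose => //.
apply: continuous_mulg; last by move=> x; exact: cvg_cst.
by apply: continuous_mulg => x; [exact: cvg_cst|exact: cvg_id].
Qed.

Lemma continuous_ltranslate f a : continuous f ->
  continuous (fun y => f (a * y)%g).
Proof.
move=> /(@continuous_translate _ a 1%g).
by under [in X in X -> _]eq_fun do rewrite mulg1.
Qed.

Lemma continuous_rtranslate f b : continuous f ->
  continuous (fun y => f (y * b)%g).
Proof.
move=> /(@continuous_translate _ 1%g b).
by under [in X in X -> _]eq_fun do rewrite mul1g.
Qed.

Lemma continuous_reflect f : continuous f -> continuous (fun y => f y^-1%g).
Proof.
by move=> cf; apply: continuous_compose => //; exact: invg_continuous.
Qed.

Lemma continuous_lsum S f : continuous f ->
  continuous (fun y => \sum_(s <- S) f (s * y)%g).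
Proof.
move=> cf; elim: S => [|s S IH].
  by under eq_fun do rewrite big_nil; exact: continuous_cstf.
under eq_fun do rewrite big_cons.
by apply: continuous_addf => //; exact: continuous_ltranslate.
Qed.

Lemma continuous_lavg S f : continuous f -> continuous (lavg S f).
Proof.
move=> cf; apply: continuous_mulf; first exact: continuous_lsum.
exact: continuous_cstf.
Qed.

Lemma ravgE T f y :
  ravg T f y = lavg [seq t^-1%g | t <- T] (fun z => f z^-1%g) y^-1%g.
Proof.
rewrite /ravg /lavg size_map big_map; congr (_ / _).
by apply: eq_bigr => t _; rewrite invgM !invgK.
Qed.

Lemma ravg_le T f c : T != [::] -> (forall y, f y <= c) ->
  forall y, ravg T f y <= c.
Proof. by move=> T0 fc y; rewrite ravgE lavg_le//; case: (T) T0. Qed.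

Lemma ravg_ge T f c : T != [::] -> (forall y, c <= f y) ->
  forall y, c <= ravg T f y.
Proof. by move=> T0 fc y; rewrite ravgE lavg_ge//; case: (T) T0. Qed.

Lemma ravg_osc f e : continuous f -> 0 < e ->
  exists2 T, T != [::] & exists c, forall y, c <= ravg T f y <= c + 3 * e.
Proof.
move=> cf e0; have [S S0 [c cP]] := lavg_osc (continuous_reflect cf) e0.
exists [seq s^-1%g | s <- S]; first by case: (S) S0.
exists c => y; rewrite ravgE -map_comp (@eq_map _ _ _ id) ?map_id// => s.
exact: invgK.
Qed.

(** By [lavg_ravg], the right average of the left average is the left average of the right one; its
    values lie above [a] and below [b]. *)
Lemma lavg_le_ravg S T f a b : S != [::] -> T != [::] ->
  (forall y, a <= lavg S f y) -> (forall y, ravg T f y <= b) -> a <= b.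
Proof.
move=> S0 T0 fa fb; rewrite (le_trans (ravg_ge T0 fa 1%g))//.
by rewrite -lavg_ravg lavg_le.
Qed.

Lemma ravg_le_lavg S T f a b : S != [::] -> T != [::] ->
  (forall y, a <= ravg T f y) -> (forall y, lavg S f y <= b) -> a <= b.
Proof.
move=> S0 T0 fa fb; rewrite (le_trans (lavg_ge S0 fa 1%g))//.
by rewrite lavg_ravg ravg_le.
Qed.

Lemma mean_value_exists f : continuous f -> exists c, mean_value f c.
Proof.
move=> cf; pose A := [set c | exists2 S, S != [::] & forall y, c <= lavg S f y].
have A0 : A !=set0.
  have [S S0 [c cP]] := lavg_osc cf ltr01.
  by exists c; exists S => // y; case/andP: (cP y).
have Aub : has_ubound A.
  have [T T0 [d dP]] := ravg_osc cf ltr01.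
  exists (d + 3 * 1) => c [S S0 Sc]; apply: (lavg_le_ravg S0 T0 Sc) => y.
  by case/andP: (dP y).
(* The mean value is the supremum of the lower bounds of left averages, while right averages bound
   it from above. The two oscillations [3 * (e / 6)] add up to [e]. *)
exists (sup A) => e e0; have e6 : 0 < e / 6 by lra.
have [S S0 [c cP]] := lavg_osc cf e6.
have [T T0 [d dP]] := ravg_osc cf e6.
exists S => // y.
have cA : c <= sup A.
  by apply: ub_le_sup => //; exists S => // z; case/andP: (cP z).
have Ad : sup A <= d + 3 * (e / 6).
  apply: ge_sup => // c' [S' S'0 S'c]; apply: (lavg_le_ravg S'0 T0 S'c) => z.
  by case/andP: (dP z).
have dc : d <= c + 3 * (e / 6).
  by apply: (@ravg_le_lavg S T f) => // z;
    [case/andP: (dP z)|case/andP: (cP z)].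
have := cP y; rewrite ler_distl; lra.
Qed.

Lemma mean_value_ravg f c e : continuous f -> mean_value f c -> 0 < e ->
  exists2 T, T != [::] & forall y, `|ravg T f y - c| <= e.
Proof.
move=> cf fc e0; have e4 : 0 < e / 4 by lra.
have [S S0 Sc] := fc _ e4; have [T T0 [d dP]] := ravg_osc cf e4.
have {}Sc y : c - e / 4 <= lavg S f y <= c + e / 4 by rewrite -ler_distl.
have cd : c - e / 4 <= d + 3 * (e / 4).
  by apply: (@lavg_le_ravg S T f) => // z;
    [case/andP: (Sc z)|case/andP: (dP z)].
have dc : d <= c + e / 4.
  by apply: (@ravg_le_lavg S T f) => // z;
    [case/andP: (dP z)|case/andP: (Sc z)].
by exists T => // y; have := dP y; rewrite ler_distl; lra.
Qed.

Lemma mean_value_unique f c S T d e : S != [::] -> T != [::] ->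
  (forall y, `|lavg S f y - c| <= e) -> (forall y, `|ravg T f y - d| <= e) ->
  `|c - d| <= 2 * e.
Proof.
move=> S0 T0 Sc Td.
have {}Sc y : c - e <= lavg S f y <= c + e by rewrite -ler_distl.
have {}Td y : d - e <= ravg T f y <= d + e by rewrite -ler_distl.
have cd : c - e <= d + e.
  by apply: (@lavg_le_ravg S T f) => // z;
    [case/andP: (Sc z)|case/andP: (Td z)].
have dc : d - e <= c + e.
  by apply: (@ravg_le_lavg S T f) => // z;
    [case/andP: (Td z)|case/andP: (Sc z)].
by rewrite ler_distl; lra.
Qed.

(** The 0 is a default for functions without a mean value; a continuous function has exactly one, by
    [mean_value_exists] and [mean_eq]. *)
Definition mean f : R := xget 0 [set c | mean_value f c].

Lemma meanP f : continuous f -> mean_value f (mean f).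
Proof. by move=> /mean_value_exists[c fc]; exact: (@xgetI _ 0 _ c). Qed.

Lemma mean_eq f c : continuous f -> mean_value f c -> mean f = c.
Proof.
move=> cf fc; apply/eqP; rewrite -subr_eq0 -normr_le0.
apply: (@lel_addgt0 _ _ _ 2) => // e e0; rewrite add0r distrC.
have [S S0 Sc] := fc e e0.
have [T T0 Td] := mean_value_ravg cf (meanP cf) e0.
exact: (mean_value_unique S0 T0 Sc Td).
Qed.

Lemma mean_eq_ravg f c : continuous f ->
  (forall e, 0 < e -> exists2 T, T != [::] & forall y,
    `|ravg T f y - c| <= e) ->
  mean f = c.
Proof.
move=> cf fc; apply/eqP; rewrite -subr_eq0 -normr_le0.
apply: (@lel_addgt0 _ _ _ 2) => // e e0; rewrite add0r.
have [T T0 Td] := fc e e0; have [S S0 Sc] := meanP cf e0.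
exact: (mean_value_unique S0 T0 Sc Td).
Qed.

Lemma mean_value_lavg f c S : S != [::] -> mean_value (lavg S f) c ->
  mean_value f c.
Proof.
move=> S0 fc e e0; have [T T0 Tc] := fc e e0.
rewrite lavg_comp in Tc; eexists; last exact: Tc.
by rewrite -size_eq0 size_allpairs muln_eq0 !size_eq0 negb_or T0.
Qed.

Lemma mean_lavg f S : continuous f -> S != [::] -> mean (lavg S f) = mean f.
Proof.
move=> cf S0; apply/esym/mean_eq => //; apply: (mean_value_lavg S0).
exact/meanP/continuous_lavg.
Qed.

(** Lists that suit [f] and [g] separately may differ. Averaging by [S], chosen for [f], and then by
    [T], chosen for [lavg S g], suits both, since averaging preserves closeness to a constant. *)
Lemma meanD f g : continuous f -> continuous g ->
  mean (fun y => f y + g y) = mean f + mean g.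
Proof.
move=> cf cg; apply: mean_eq; first exact: continuous_addf.
move=> e e0; have e2 : 0 < e / 2 by lra.
have [S S0 Sf] := meanP cf e2.
have [T T0 Tg] := meanP (continuous_lavg (S:=S) cg) e2.
exists [seq (t * s)%g | s <- T, t <- S].
  by rewrite -size_eq0 size_allpairs muln_eq0 !size_eq0 negb_or T0.
move=> y; rewrite lavgD -!lavg_comp.
rewrite opprD addrACA (le_trans (ler_normD _ _))// (splitr e) lerD//.
  exact: lavg_dist.
by rewrite -(mean_lavg cg S0).
Qed.

Lemma meanZ a f : continuous f -> mean (fun y => a * f y) = a * mean f.
Proof.
move=> cf; apply: mean_eq; first exact: continuous_scalef.
move=> e e0; have d0 : 0 < e / (`|a| + 1) by rewrite divr_gt0// ltr_wpDl.
have [S S0 Sf] := meanP cf d0; exists S => // y.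
rewrite lavgZ -mulrBr normrM.
rewrite (le_trans (ler_wpM2l (normr_ge0 _) (Sf y)))//
  mulrCA ler_piMr ?(ltW e0)//.
by rewrite ler_pdivrMr ?ltr_wpDl// mul1r lerDl.
Qed.

Lemma mean_le f c : continuous f -> (forall y, f y <= c) -> mean f <= c.
Proof.
move=> cf fc; apply/ler_addgt0Pr => e e0.
have [S S0 Sf] := meanP cf e0; have := Sf 1%g; have := lavg_le S0 fc 1%g.
by rewrite ler_distl; lra.
Qed.

Lemma mean_ge f c : continuous f -> (forall y, c <= f y) -> c <= mean f.
Proof.
move=> cf fc; apply/ler_addgt0Pr => e e0.
have [S S0 Sf] := meanP cf e0; have := Sf 1%g; have := lavg_ge S0 fc 1%g.
by rewrite ler_distl; lra.
Qed.

Lemma mean_cst c : mean (fun=> c) = c.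
Proof.
apply/eqP; rewrite eq_le mean_le ?mean_ge//; exact: continuous_cstf.
Qed.

Lemma meanB f g : continuous f -> continuous g ->
  mean (fun y => f y - g y) = mean f - mean g.
Proof.
move=> cf cg; rewrite -mulN1r -meanZ// -meanD//; last exact: continuous_scalef.
by under [in RHS]eq_fun do rewrite mulN1r.
Qed.

(** Right averages commute with left translation, so those of the translate approach the same
    constant; [mean_rtranslate] uses left averages in the same way. *)
Lemma mean_ltranslate f a : continuous f -> mean (fun y =>
  f (a * y)%g) = mean f.
Proof.
move=> cf; apply: mean_eq_ravg; first exact: continuous_ltranslate.
move=> e e0; have [T T0 Td] := mean_value_ravg cf (meanP cf) e0.
exists T => // y; have := Td (a * y)%g; rewrite /ravg.
by under eq_bigr do rewrite -mulgA.
Qed.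

Lemma mean_rtranslate f a : continuous f -> mean (fun y =>
  f (y * a)%g) = mean f.
Proof.
move=> cf; apply: mean_eq; first exact: continuous_rtranslate.
move=> e e0; have [S S0 Sd] := meanP cf e0.
exists S => // y; have := Sd (y * a)%g; rewrite /lavg.
by under eq_bigr do rewrite mulgA.
Qed.

(** Finitely many translates of a neighbourhood where [f] is at least half of [f x0] cover [G], so
    some average of [f] has a positive lower bound. *)
Lemma mean_gt0 f x0 : continuous f -> (forall y, 0 <= f y) -> 0 < f x0 ->
  0 < mean f.
Proof.
move=> cf f0 fx0; have fx2 : 0 < f x0 / 2 by lra.
have [l lP] : exists l : seq G, forall z, exists2 g, g \in l &
    f x0 / 2 <= f (x0 * (g^-1 * z))%g.
  have /cvgrPdist_le/(_ _ fx2) n1 := continuous_ltranslate (a:=x0) cf (x :=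
    1%g).
  have [l lP] := translates_cover n1; exists l => z.
  have [g gl gP] := lP z; exists g => //; move: gP.
  by rewrite /= mulg1 ler_distlC; lra.
have l0 : l != [::] by case: (lP 1%g) => g; case: (l).
have n0 : 0 < (size l)%:R :> R by rewrite ltr0n lt0n size_eq0.
pose S := [seq (x0 * a^-1)%g | a <- l].
have S0 : S != [::] by rewrite /S; case: (l) l0.
rewrite -(mean_lavg cf S0); apply: (@lt_le_trans _ _ (f x0 / 2 / (size l)%:R)).
  by rewrite divr_gt0.
apply: mean_ge => [|y]; first exact: continuous_lavg.
rewrite /lavg size_map ler_pM2r ?invr_gt0// big_map.
have [g gl gP] := lP y; rewrite (big_rem g)//= -mulgA.
by rewrite (le_trans gP)// lerDl sumr_ge0.
Qed.

(** Such an [L] is unchanged by averaging, and a suitable average is uniformly close to the constant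
    [mean f]. This is the source of Fubini's theorem below. *)
Lemma mean_unique (L : (G -> R) -> R) :
  (forall f g, continuous f -> continuous g ->
     L (fun y => f y + g y) = L f + L g) ->
  (forall a f, continuous f -> L (fun y => a * f y) = a * L f) ->
  (forall f c, continuous f -> (forall y, f y <= c) -> L f <= c) ->
  (forall f a, continuous f -> L (fun y => f (a * y)%g) = L f) ->
  forall f, continuous f -> L f = mean f.
Proof.
move=> LD LZ Lle Ll f cf.
have Lge g c : continuous g -> (forall y, c <= g y) -> c <= L g.
  move=> cg gc; rewrite -lerN2 -mulN1r -LZ//; apply: Lle => [|y].
    exact: continuous_scalef.
  by rewrite mulN1r lerN2.
have Lsum S : L (fun y => \sum_(s <- S) f (s * y)%g) = (size S)%:R * L f.
  elim: S => [|s S IH] /=.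
    have := LZ 0 f cf; under eq_fun do rewrite mul0r.
    by under [in X in _ -> X]eq_fun do rewrite big_nil.
  under eq_fun do rewrite big_cons.
  rewrite LD ?IH ?Ll//; first by rewrite -[(size S).+1%:R]nat1r mulrDl mul1r.
    exact: continuous_ltranslate.
  exact: continuous_lsum.
have Lavg S : S != [::] -> L (lavg S f) = L f.
  move=> S0; have S1 : (size S)%:R != 0 :> R by rewrite pnatr_eq0 size_eq0.
  apply: (mulfI S1); rewrite -Lsum -LZ; last exact: continuous_lavg.
  by congr L; apply/funext => y; rewrite mulrC divfK.
apply/eqP; rewrite -subr_eq0 -normr_le0.
apply/ler_addgt0Pr => e e0; rewrite add0r.
have [S S0 Sf] := meanP cf e0; rewrite -(Lavg S S0) ler_distl.
have cS := continuous_lavg (S:=S) cf.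
have {}Sf y : mean f - e <= lavg S f y <= mean f + e by rewrite -ler_distl.
by apply/andP; split; [apply: Lge|apply: Lle] => // y; case/andP: (Sf y).
Qed.

End Mean.

(** * Products and iterated means *)

Section ProductGroup.
Variables G H : compactGroupType.

Let mulg_cts : continuous (fun p : (G * H) * (G * H) => (p.1 * p.2)%g).
Proof.
apply: continuous_pair; apply: continuous_mulg; apply: continuous_compose;
  by [exact: fst_continuous|exact: snd_continuous].
Qed.

Let invg_cts : continuous (fun p : G * H => p^-1%g).
Proof.
apply: continuous_pair; apply: continuous_invg;
  by [exact: fst_continuous|exact: snd_continuous].
Qed.

HB.instance Definition _ :=
  PreTopologicalGroup_isTopologicalGroup.Build (G * H)%type mulg_cts invg_cts.

Let compact_prod : compact [set: G * H].
Proof. by rewrite -setXTT; apply: compact_setX; exact: compact_setT. Qed.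

Let hausdorff_prod : hausdorff_space (G * H)%type.
Proof.
move=> [a b] [c d] ab; congr (_, _); apply: hausdorff_setT => A B nA nB.
- have [] := ab (A `*` setT) (B `*` setT).
  + by exists (A, setT) => //=; split=> //; exact: filterT.
  + by exists (B, setT) => //=; split=> //; exact: filterT.
  by move=> [x y] [[Ax _] [Bx _]]; exists x.
- have [] := ab (setT `*` A) (setT `*` B).
  + by exists (setT, A) => //=; split=> //; exact: filterT.
  + by exists (setT, B) => //=; split=> //; exact: filterT.
  by move=> [x y] [[_ Ay] [_ By]]; exists y.
Qed.

HB.instance Definition _ :=
  Topological_isCompactHausdorff.Build (G * H)%type compact_prod hausdorff_prod.

End ProductGroup.

Section IteratedMeans.
Context {R : realType}.

Lemma mean_dist (G : compactGroupType) (f g : G -> R) e :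
  continuous f -> continuous g ->
  (forall y, `|f y - g y| <= e) -> `|mean f - mean g| <= e.
Proof.
move=> cf cg fg.
have cfg : continuous (fun y => f y - g y).
  by apply: continuous_addf => //; under eq_fun do rewrite -mulN1r;
    exact: continuous_scalef.
by rewrite -meanB// ler_norml mean_ge ?mean_le// => y; have := fg y;
  rewrite ler_norml => /andP[].
Qed.

Lemma continuous_section (X Y Z : topologicalType) (F : X * Y -> Z) x :
  continuous F -> continuous (fun y => F (x, y)).
Proof.
move=> cF; apply: (continuous_compose cF).
by apply: continuous_pair => y; [exact: cvg_cst|exact: cvg_id].
Qed.

Lemma continuous_mean (X : topologicalType) (G : compactGroupType)
  (F : X * G -> R) : continuous F -> continuous (fun x => mean (fun g => F (x,
    g))).
Proof.
move=> cF x; apply/cvgrPdist_le => e e0.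
have := near_uniformly x cF e0; apply: filterS => y h.
by rewrite distrC; apply: mean_dist => //; exact: continuous_section.
Qed.

(** The iterated mean is again a normalised positive functional invariant under left translation, so
    [mean_unique] identifies it; [mean_exchange] treats the swap of coordinates likewise. *)
Lemma mean_pair (G H : compactGroupType) (F : G * H -> R) : continuous F ->
  mean (fun x => mean (fun y => F (x, y))) = mean F.
Proof.
have c (F' : G * H -> R) x : continuous F' -> continuous (fun y => F' (x, y)).
  exact: continuous_section.
have cm (F' : G * H -> R) : continuous F' -> continuous (fun x =>
  mean (fun y => F' (x, y))).
  exact: continuous_mean.
apply: (@mean_unique _ _ (fun F => mean (fun x => mean (fun y => F (x, y))))).
- move=> f g cf cg; rewrite -meanD//; try exact: cm.
  by congr mean; apply/funext => x; rewrite meanD//; exact: c.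
- move=> a f cf; rewrite -meanZ//; last exact: cm.
  by congr mean; apply/funext => x; rewrite meanZ//; exact: c.
- move=> f b cf fb; apply: mean_le => [|x]; first exact: cm.
  by apply: mean_le; [exact: c|].
- move=> f [a b] cf.
  rewrite -[RHS](mean_ltranslate a); last exact: cm.
  congr mean; apply/funext => x.
  by rewrite -[RHS](mean_ltranslate b); last exact: c.
Qed.

Lemma mean_exchange (G H : compactGroupType) (F : G * H -> R) : continuous F ->
  mean (fun x => mean (fun y => F (x, y))) =
  mean (fun y => mean (fun x => F (x, y))).
Proof.
move=> cF; rewrite mean_pair//.
have cs (f : G * H -> R) : continuous f -> continuous (fun p => f (p.2, p.1)).
  move=> cf; apply: (continuous_compose cf).
  by apply: continuous_pair; [exact: snd_continuous|exact: fst_continuous].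
rewrite (mean_pair (cs _ cF)); apply/esym.
apply: (@mean_unique _ _ (fun f => mean (fun p => f (p.2, p.1)))) => //.
- by move=> f g cf cg; rewrite meanD//; exact: cs.
- by move=> a f cf; rewrite meanZ//; exact: cs.
- by move=> f c cf fc; apply: mean_le; [exact: cs|].
- move=> f [a b] cf.
  by rewrite -[RHS](mean_ltranslate (b, a)); last exact: cs.
Qed.

End IteratedMeans.

(** * Convolution operators *)

Lemma continuous_oppf (R : realType) (X : topologicalType) (f : X -> R) :
  continuous f -> continuous (fun x => - f x).
Proof. by move=> cf x; apply: cvgN; exact: cf. Qed.

Ltac cts := intros; repeat first
  [ assumption | exact: continuous_cstf | apply: continuous_addf
  | apply: continuous_oppf | apply: continuous_mulf ].

Section InnerProduct.
Context {R : realType} {G : compactGroupType}.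
Implicit Types f g h : G -> R.

Definition ip f g := mean (fun x => f x * g x).

Lemma ipC f g : ip f g = ip g f.
Proof. by congr mean; apply/funext => x; rewrite mulrC. Qed.

Lemma ip0l g : ip (fun=> 0) g = 0.
Proof.
by rewrite /ip -[RHS](@mean_cst R G); congr mean; apply/funext => x;
  rewrite mul0r.
Qed.

Lemma ip_linear f g h a : continuous f -> continuous g -> continuous h ->
  ip (fun x => f x + a * g x) h = ip f h + a * ip g h.
Proof.
move=> cf cg ch; rewrite /ip -meanZ -?meanD; try by cts.
by congr mean; apply/funext => x; rewrite mulrDl mulrA.
Qed.

Lemma ip_ge0 f : continuous f -> 0 <= ip f f.
Proof. by move=> cf; apply: mean_ge => [|y]; [cts|exact: sqr_ge0]. Qed.

Lemma ip_eq0 f : continuous f -> ip f f = 0 -> f = fun=> 0.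
Proof.
move=> cf ff0; apply/funext => x; apply/eqP/negP => fx.
have : 0 < ip f f.
  apply: (@mean_gt0 _ _ _ x) => [|y|]; first by cts.
    exact: sqr_ge0.
  by rewrite -expr2 exprn_even_gt0//=; exact/negP.
by rewrite ff0 ltxx.
Qed.

Lemma ip_gt0 f : continuous f -> f <> (fun=> 0) -> 0 < ip f f.
Proof.
move=> cf f0; rewrite lt_neqAle ip_ge0// andbT eq_sym.
by apply/eqP => /(ip_eq0 cf).
Qed.

Lemma ip_le f e : continuous f -> (forall x, `|f x| <= e) -> ip f f <= e ^+ 2.
Proof.
move=> cf fe; apply: mean_le => [|y]; first by cts.
rewrite -expr2 -real_normK ?num_real// lerXn2r ?nnegrE//.
exact: le_trans (fe y).
Qed.

Lemma ip_sqrD f g a : continuous f -> continuous g ->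
  ip (fun x => f x + a * g x) (fun x => f x + a * g x) =
  ip f f + 2 * a * ip f g + a ^+ 2 * ip g g.
Proof.
move=> cf cg; rewrite ip_linear//; last by cts.
rewrite (ipC f) (ipC g) !ip_linear// (ipC g f); ring.
Qed.

Lemma cauchy_schwarz f g : continuous f -> continuous g ->
  ip f g ^+ 2 <= ip f f * ip g g.
Proof.
move=> cf cg; have [g0|/(ip_gt0 cg) g0] := pselect (g = fun=> 0).
  by rewrite ipC [X in ip X f]g0 ip0l expr0n mulr_ge0// ip_ge0.
have := @ip_ge0 (fun x => f x + (- (ip f g / ip g g)) * g x).
rewrite ip_sqrD// => /(_ ltac:(cts)).
have -> : ip f f + 2 * - (ip f g / ip g g) * ip f g +
    (- (ip f g / ip g g)) ^+ 2 * ip g g = ip f f - ip f g ^+ 2 / ip g g.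
  by field; rewrite gt_eqF.
by rewrite subr_ge0 ler_pdivrMr.
Qed.

Lemma ip_ltranslate f g a : continuous f -> continuous g ->
  ip (fun x => f (a * x)%g) (fun x => g (a * x)%g) = ip f g.
Proof. by move=> cf cg; rewrite /ip -[RHS](mean_ltranslate a)//; cts. Qed.

End InnerProduct.

Section Convolution.
Context {R : realType} {G : compactGroupType}.
Variable k : G -> R.
Hypothesis ck : continuous k.
Implicit Types f g h : G -> R.

(** Convolution of [f] on the right with the reflected kernel. Dependence on [x^-1 * y] alone makes
    it commute with left translation. *)
Definition conv f : G -> R := fun x => mean (fun y => k (x^-1 * y)%g * f y).

Lemma continuous_kernel : continuous (fun p : G * G => k (p.1^-1 * p.2)%g).
Proof.
apply: (continuous_compose ck); apply: continuous_mulg.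
  by apply: continuous_invg; exact: fst_continuous.
exact: snd_continuous.
Qed.

Lemma continuous_integrand f : continuous f ->
  continuous (fun p : G * G => k (p.1^-1 * p.2)%g * f p.2).
Proof.
move=> cf; apply: continuous_mulf; first exact: continuous_kernel.
exact/(continuous_compose cf)/snd_continuous.
Qed.

Lemma continuous_conv f : continuous f -> continuous (conv f).
Proof. by move=> /continuous_integrand/continuous_mean. Qed.

Lemma conv_linear f g a : continuous f -> continuous g ->
  conv (fun x => f x + a * g x) = fun x => conv f x + a * conv g x.
Proof.
move=> cf cg; apply/funext => x; rewrite /conv -meanZ -?meanD.
- by congr mean; apply/funext => y; ring.
- exact: (continuous_section (x := x) (continuous_integrand cf)).
- exact/continuous_scalef/(continuous_section (x :=
  x) (continuous_integrand cg)).
- exact: (continuous_section (x := x) (continuous_integrand cg)).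
Qed.

Lemma conv0 : conv (fun=> 0) = fun=> 0.
Proof.
by apply/funext => x; rewrite /conv; under eq_fun do rewrite mulr0;
  exact: mean_cst.
Qed.

Lemma conv_ltranslate f a : continuous f ->
  conv (fun y => f (a * y)%g) = fun x => conv f (a * x)%g.
Proof.
move=> cf; apply/funext => x; rewrite /conv -[RHS](mean_ltranslate a).
  by congr mean; apply/funext => y; rewrite invgM -!mulgA mulKg.
exact: (continuous_section (x := (a * x)%g) (continuous_integrand cf)).
Qed.

Lemma conv_le f x : continuous f -> conv f x ^+ 2 <= ip k k * ip f f.
Proof.
move=> cf; have := @cauchy_schwarz _ _ (fun y => k (x^-1 * y)%g) f.
by rewrite (@ip_ltranslate _ _ k k)//; apply=> //; exact: continuous_ltranslate.
Qed.

Lemma ip_conv_le f : continuous f -> ip (conv f) (conv f) <= ip k k * ip f f.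
Proof.
move=> cf; apply: mean_le => [|x]; last by rewrite -expr2 conv_le.
by apply: continuous_mulf; exact: continuous_conv.
Qed.

(** The difference is the inner product of [f] with a difference of two translates of [k], uniformly
    small for [u] near 1. By Cauchy-Schwarz only the L2 norm of [f] enters, so the image of the
    whole unit ball is equicontinuous. *)
Lemma conv_equicontinuous (e : R) : 0 < e ->
  \forall u \near (1%g : G), forall f, continuous f -> ip f f <= 1 ->
    forall x, `|conv f (x * u)%g - conv f x| <= e.
Proof.
move=> e0; have := near_uniformly (1%g : G) continuous_kernel e0.
apply: filterS => u /= ku f cf f1 x.
pose d y := k (u^-1 * (x^-1 * y))%g - k (x^-1 * y)%g.
have cd : continuous d.
  apply: continuous_addf; last first.
    by apply: continuous_oppf; exact: continuous_ltranslate.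
  by under eq_fun do rewrite mulgA; exact: continuous_ltranslate.
have -> : conv f (x * u)%g - conv f x = ip d f.
  rewrite /conv -meanB.
  - by congr mean; apply/funext => y; rewrite /d invgM mulgA mulrBl.
  - exact: (continuous_section (x := (x * u)%g) (continuous_integrand cf)).
  - exact: (continuous_section (x := x) (continuous_integrand cf)).
have e0' := ltW e0; rewrite -(@ler_pXn2r _ 2)// ?nnegrE//
  real_normK ?num_real//.
rewrite (le_trans (cauchy_schwarz cd cf))// -[leRHS]mulr1.
rewrite ler_pM ?ip_ge0// ip_le// => y.
by have := ku (x^-1 * y)%g; rewrite invg1 mul1g.
Qed.

Hypothesis k_sym : forall x, k x^-1%g = k x.

Lemma conv_sym f g : continuous f -> continuous g ->
  ip (conv f) g = ip f (conv g).
Proof.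
move=> cf cg; pose F (p : G * G) := k (p.1^-1 * p.2)%g * f p.2 * g p.1.
have cF : continuous F.
  apply: continuous_mulf; first exact: continuous_integrand.
  exact/(continuous_compose cg)/fst_continuous.
transitivity (mean (fun x => mean (fun y => F (x, y)))).
  congr mean; apply/funext => x; rewrite mulrC /conv -meanZ.
    by congr mean; apply/funext => y; rewrite mulrC.
  exact: (continuous_section (x := x) (continuous_integrand cf)).
rewrite mean_exchange//; congr mean; apply/funext => y; rewrite /conv -meanZ.
  congr mean; apply/funext => x; rewrite /F/= -(k_sym (x^-1 * y)) invgM invgK.
  by rewrite mulrAC mulrC.
exact: (continuous_section (x := y) (continuous_integrand cg)).
Qed.

End Convolution.

(** * Eigenvectors *)

Lemma nbhs_pointwise (R : realType) (I : eqType) (T : pseudoMetricType R)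
    (b : prod_topology (fun _ : I => T)) (s : seq I) (e : R) :
  0 < e -> nbhs b [set f : I -> T | forall i, i \in s -> ball (b i) e (f i)].
Proof.
move=> e0; have FF := nbhs_filter b; elim: s => [|i s IH].
  by apply: (@filterS _ (nbhs b) FF setT) => //;
    exact: (@filterT _ (nbhs b) FF).
have /cvg_ballP/(_ _ e0) bi := @proj_continuous I (fun=> T) i b.
apply: (@filterS2 _ (nbhs b) FF _ _ _ _ IH bi) => f sf /= bf j.
by rewrite inE => /predU1P[->//|]; exact: sf.
Qed.

Section UniformLimits.
Context {R : realType} {G : compactGroupType}.
Implicit Types f g h : G -> R.

Definition unif_adherent (Y : set (G -> R)) b :=
  forall e : R, 0 < e -> exists2 f, Y f & forall x, `|f x - b x| <= e.

Lemma unif_adherent_continuous (Y : set (G -> R)) b :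
  (forall f, Y f -> continuous f) -> unif_adherent Y b -> continuous b.
Proof.
move=> cY Yb x; apply/cvgrPdist_le => /= e e0; have e3 : 0 < e / 3 by lra.
have [f Yf fb] := Yb _ e3.
have /cvgrPdist_le/(_ _ e3) := cY f Yf x; apply: filterS => y fxy.
have := fb x; have := fb y; move: fxy; rewrite !ler_norml; lra.
Qed.

(* Tychonoff gives a pointwise cluster point; equicontinuity upgrades it to a
   uniform one. *)
Lemma equicontinuous_cluster (F : set_system (G -> R)) (W : set (G ->
  R)) (c : R) :
  ProperFilter F -> F W -> (forall f x, W f -> `|f x| <= c) ->
  (forall e : R, 0 < e -> \forall u \near (1%g : G), forall f, W f ->
     forall x, `|f (x * u)%g - f x| <= e) ->
  exists b, forall A, F A -> unif_adherent (A `&` W) b.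
Proof.
move=> FF FW Wc We.
have cc : compact
    ([set f | forall i, f i \in `[- c, c]] : set (prod_topology (fun _ : G =>
      R))).
  apply: (@tychonoff G (fun=> R) (fun=> [set` `[- c, c]])) => i.
  exact: segment_compact.
have [|b [_ Fb]] := cc F FF.
  apply: filterS FW => f Wf x /=; rewrite in_itv/=.
  by have := Wc f x Wf; rewrite ler_norml.
(* Five steps of [e / 5] join [f z] to [b z], through [f g], [b g], [h g] and [h z]. The function
   [h] depends on [z], but [f] only on the finite list [l]. *)
exists b => A FA e e0; have e5 : 0 < e / 5 by lra.
have clus (s : seq G) : exists2 f, (A `&` W) f &
    forall x, x \in s -> `|f x - b x| <= e / 5.
  have [f [AWf sf]] := Fb _ _ (filterI FA FW) (nbhs_pointwise b s e5).
  by exists f => // x /sf; rewrite /ball/= distrC => /ltW.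
have [l lP] := translates_cover (We _ e5).
have [f AWf fb] := clus l; exists f => // z.
have [g gl gP] := lP z.
have [h AWh hb] := clus [:: g; z].
have := gP h AWh.2 g; have := gP f AWf.2 g; rewrite mulgA mulgV mul1g.
have := fb g gl.
have := hb g (mem_head _ _); have := hb z; rewrite !inE eqxx orbT => /(_ isT).
rewrite !ler_norml; lra.
Qed.

End UniformLimits.

Section Eigenvector.
Context {R : realType} {G : compactGroupType}.
Variable k : G -> R.
Hypothesis ck : continuous k.
Hypothesis k_sym : forall x, k x^-1%g = k x.
Implicit Types (f g h : G -> R) (a : R).
Local Notation T := (conv k).

(** Compactness of [T] from the L2 norm to the uniform norm, phrased with filters. The bound
    [ip k k + 1] is a root-free majorant of the L2 norm of [k]. *)
Lemma conv_cluster (F : set_system (G -> R)) : ProperFilter F ->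
  F [set h | exists f, [/\ continuous f, ip f f <= 1 & h = T f]] ->
  exists b, forall A, F A -> unif_adherent A b.
Proof.
move=> FF FW; have [b bP] : exists b, forall A, F A -> unif_adherent (A `&`
    [set h | exists f, [/\ continuous f, ip f f <= 1 & h = T f]]) b.
  apply: (@equicontinuous_cluster _ _ _ _ (ip k k + 1)) => //.
  - move=> _ x [f [cf f1 ->]].
    have k0 : 0 <= ip k k by exact: ip_ge0.
    have k1 : 0 <= ip k k + 1 by lra.
    rewrite -(@ler_pXn2r _ 2)// ?nnegrE// real_normK ?num_real//.
    rewrite (le_trans (conv_le ck _ cf))//.
    rewrite (le_trans (ler_wpM2l k0 f1))// mulr1; nra.
  - move=> e e0; have := conv_equicontinuous ck e0.
    by apply: filterS => u h _ [f [cf f1 ->]] x; exact: h.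
by exists b => A FA e e0; have [f [Af _] fb] := bP A FA e e0; exists f.
Qed.

Variable Y : set (G -> R).
Hypothesis Y_continuous : forall f, Y f -> continuous f.
Hypothesis Y_linear : forall f g (a : R), Y f -> Y g -> Y (fun x =>
  f x + a * g x).
Hypothesis Y_conv : forall f, Y f -> Y (T f).
Hypothesis Y_closed : forall b, unif_adherent Y b -> Y b.

Let Y_scale f a : Y f -> Y (fun x => a * f x).
Proof.
move=> Yf; have := Y_linear (a - 1) Yf Yf; congr Y.
by apply/funext => x; ring.
Qed.

Let ip_scale f a : continuous f ->
  ip (fun x => a * f x) (fun x => a * f x) = a ^+ 2 * ip f f.
Proof.
move=> cf; rewrite -meanZ; last by cts.
by congr mean; apply/funext => x; ring.
Qed.

Let conv_scale f a : continuous f -> T (fun x => a * f x) = fun x => a * T f x.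
Proof.
move=> cf; have := conv_linear ck (a - 1) cf cf.
have -> : (fun x => f x + (a - 1) * f x) = (fun x => a * f x).
  by apply/funext => x; ring.
by move=> ->; apply/funext => x; ring.
Qed.

(** The supremum [beta] of these values is the squared operator norm of [T] on [Y]. *)
Let A := [set r : R | exists f, [/\ Y f, ip f f <= 1 & r = ip (T f) (T f)]].
Let beta := sup A.

Let A_sup f0 : Y f0 -> has_sup A.
Proof.
move=> Yf0; split.
  exists (ip (T (fun x => 0 * f0 x)) (T (fun x => 0 * f0 x))).
  exists (fun x => 0 * f0 x); split=> //; first exact: Y_scale.
  by rewrite ip_scale ?expr0n ?mul0r//; exact: Y_continuous.
exists (ip k k) => _ [f [Yf f1 ->]].
rewrite (le_trans (ip_conv_le ck (Y_continuous Yf)))//.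
by rewrite ler_piMr// ip_ge0.
Qed.

Let ip_conv_beta f : Y f -> ip (T f) (T f) <= beta * ip f f.
Proof.
move=> Yf; have cf := Y_continuous Yf.
have [f0|/(ip_gt0 cf) f0] := pselect (f = fun=> 0).
  by rewrite f0 conv0 !ip0l mulr0.
have s0 : 0 < Num.sqrt (ip f f) by rewrite sqrtr_gt0.
have s2 : (Num.sqrt (ip f f))^-1 ^+ 2 = (ip f f)^-1.
  by rewrite exprVn sqr_sqrtr// ltW.
rewrite -ler_pdivrMr// mulrC -s2 -ip_scale; last exact: continuous_conv.
rewrite -conv_scale//; apply: ub_le_sup; first by case: (A_sup Yf).
exists (fun x => (Num.sqrt (ip f f))^-1 * f x); split=> //.
  exact: Y_scale.
by rewrite ip_scale// s2 mulVf// gt_eqF.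
Qed.

(** With [h = T f], symmetry gives [|T h - beta f|^2 <= beta (beta - |h|^2)], so near-maximisers
    nearly satisfy [T (T f) = beta f]. They need not converge themselves, but their images [T f]
    have a uniform cluster point [b], and one more application of [T] turns the relation into
    [T (T b) = beta b]. *)
Lemma square_eigenvector f0 : Y f0 -> T f0 <> (fun=> 0) ->
  exists b (mu : R), [/\ Y b, 0 < mu, b <> (fun=> 0) &
    T (T b) = fun x => mu * b x].
Proof.
move=> Yf0 Tf0; have cf0 := Y_continuous Yf0.
have beta0 : 0 < beta.
  have := ip_gt0 (continuous_conv ck cf0) Tf0.
  have := ip_conv_beta Yf0; have := ip_ge0 cf0; nra.
pose P (e : R) := [set h | exists f,
  [/\ Y f, ip f f <= 1, beta - e <= ip (T f) (T f) & h = T f]].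
pose F := filter_from [set e : R | 0 < e] P.
have FF : ProperFilter F.
  apply: filter_from_proper.
    apply: filter_from_filter; first by exists 1 => /=.
    move=> e1 e2 /= e10 e20; exists (Num.min e1 e2) => /=.
      by rewrite lt_min e10.
    move=> h [f [Yf f1 fe ->]].
    by split; exists f; split=> //; apply: le_trans fe;
      rewrite lerB// ge_min lexx ?orbT.
  move=> e /= e0; have [_ [f [Yf f1 ->]] fe] := sup_adherent e0 (A_sup Yf0).
  by exists (T f), f; split=> //; exact: ltW.
have [|b bP] := conv_cluster FF.
  by exists 1 => //= h [f [Yf f1 _ ->]]; exists f; split=> //;
    exact: Y_continuous.
have {}bP (e : R) : 0 < e -> exists f, [/\ Y f, ip f f <= 1,
    beta - e <= ip (T f) (T f) & forall x, `|T f x - b x| <= e].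
  move=> e0; have [|h [f [Yf f1 fe ->]] hb] := bP (P e) _ e e0;
    last by exists f.
  by exists e.
have Yb : Y b.
  apply: Y_closed => e /bP[f [Yf _ _ fb]]; exists (T f) => //.
  exact: Y_conv.
have cb := Y_continuous Yb.
exists b, beta; split=> //.
  (* If [b] were 0, then [beta - m <= ip (T f) (T f) <= m ^+ 2 <= m] with [m <= beta / 4], against
     [beta > 0]. *)
  move=> b0; have /bP[f [Yf f1 fe fb]] : 0 < Num.min 1 (beta / 4).
    by rewrite lt_min ltr01 divr_gt0.
  have := @ip_le _ _ (T f) (Num.min 1 (beta / 4)) (continuous_conv ck
    (Y_continuous Yf)).
  rewrite b0 in fb; move: fe fb; set m := Num.min _ _ => fe fb H.
  have m1 : m <= 1 by rewrite ge_min lexx.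
  have m4 : m <= beta / 4 by rewrite ge_min lexx orbT.
  have m0 : 0 < m by rewrite lt_min ltr01 divr_gt0.
  have {}H : ip (T f) (T f) <= m ^+ 2.
    by apply: H => x; have := fb x; rewrite subr0.
  have : m ^+ 2 <= m by rewrite expr2 ler_piMr// ltW.
  lra.
apply/funext => x; apply/eqP; rewrite -subr_eq0 -sqrf_eq0 eq_le sqr_ge0 andbT.
have k0 : 0 <= ip k k by exact: ip_ge0.
(* The 3 comes from [(p + q + r)^2 <= 3 (p^2 + q^2 + r^2)], used for the splitting of
   [T (T b) x - beta * b x] below; the three coefficients bound the three squares, up to a factor
   [m <= 1]. *)
apply: (@lel_addgt0 _ _ _ (3 * (ip k k ^+ 2 + ip k k * beta + beta ^+ 2))).
  by have := sqr_ge0 (ip k k); have := mulr_ge0 k0 (ltW beta0); nra.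
move=> e e0; rewrite add0r; set D := 3 * _.
have D0 : 0 <= D.
  by rewrite mulr_ge0// !addr_ge0 ?sqr_ge0// mulr_ge0// ltW.
have /bP[f [Yf f1 fe fb]] : 0 < Num.min 1 e by rewrite lt_min ltr01.
rewrite (@le_trans _ _ (D * Num.min 1 e))//; last first.
  by rewrite ler_wpM2l// ge_min lexx orbT.
have m1 : Num.min 1 e <= 1 by rewrite ge_min lexx.
have m0 : 0 < Num.min 1 e by rewrite lt_min ltr01.
move: (Num.min 1 e) m0 m1 fe fb => m m0 m1 fe fb.
have cf := Y_continuous Yf; pose h := T f.
have ch : continuous h by exact: continuous_conv.
have Yh : Y h by exact: Y_conv.
pose u y := b y + (-1) * h y.
have cu : continuous u by apply: continuous_addf => //;
  exact: continuous_scalef.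
have uu : ip u u <= m ^+ 2.
  by apply: ip_le => // y; rewrite /u mulN1r distrC fb.
pose g y := T h y + (- beta) * f y.
have cg : continuous g.
  by apply: continuous_addf; [exact: continuous_conv|exact: continuous_scalef].
have gg : ip g g <= beta * m.
  rewrite /g ip_sqrD//; last exact: continuous_conv.
  rewrite (conv_sym ck k_sym ch cf) -/h.
  have := ip_conv_beta Yh; move: fe; rewrite -/h; nra.
have -> : T (T b) x - beta * b x = T (T u) x + T g x + beta * (h x - b x).
  rewrite (conv_linear ck _ cb ch) (conv_linear ck); try exact: continuous_conv.
  rewrite (conv_linear ck _ (continuous_conv ck ch) cf) -/h; ring.
have Tu : T (T u) x ^+ 2 <= ip k k ^+ 2 * m.
  rewrite (le_trans (conv_le ck _ (continuous_conv ck cu)))// expr2 -mulrA.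
  rewrite ler_wpM2l// (le_trans (ip_conv_le ck cu))// ler_wpM2l//.
  by rewrite (le_trans uu)// expr2 ler_piMr// ltW.
have Tg : T g x ^+ 2 <= ip k k * beta * m.
  by rewrite (le_trans (conv_le ck _ cg))// -mulrA ler_wpM2l.
have hb : (beta * (h x - b x)) ^+ 2 <= beta ^+ 2 * m.
  rewrite exprMn ler_wpM2l ?sqr_ge0//.
  have := fb x; rewrite -/h ler_norml; nra.
rewrite /D; move: Tu Tg hb.
move: (T (T u) x) (T g x) (beta * (h x - b x)) => p q r.
have := sqr_ge0 (p - q); have := sqr_ge0 (q - r); have := sqr_ge0 (p - r); lra.
Qed.

(** [T^2 - mu] factors as [(T - s) (T + s)] with [s] the square root of [mu]: either [T b + s b]
    vanishes and [b] has eigenvalue [- s], or it is an eigenvector for [s]. *)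
Lemma eigenvector_exists f0 : Y f0 -> T f0 <> (fun=> 0) ->
  exists v (lam : R), [/\ Y v, lam != 0, v <> (fun=> 0) &
    T v = fun x => lam * v x].
Proof.
move=> Yf0 Tf0; have [b [mu [Yb mu0 b0 Tb]]] := square_eigenvector Yf0 Tf0.
have cb := Y_continuous Yb; set s := Num.sqrt mu.
have s0 : s != 0 by rewrite gt_eqF// sqrtr_gt0.
have s2 : s * s = mu by rewrite -expr2 sqr_sqrtr// ltW.
have [w0|w0] := pselect ((fun x => T b x + s * b x) = (fun=> 0)).
  exists b, (- s); split=> //; first by rewrite oppr_eq0.
  apply/funext => x; have := congr1 (@^~ x) w0 => /= wx.
  by apply/eqP; rewrite mulNr -addr_eq0 wx.
exists (fun x => T b x + s * b x), s; split=> //.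
  exact/Y_linear/Yb/Y_conv.
rewrite (conv_linear ck)//; last exact: continuous_conv.
by rewrite Tb; apply/funext => x; rewrite -s2; ring.
Qed.

End Eigenvector.

(** * Invariant functions *)

Section Bumps.
Context {R : realType} {G : compactGroupType}.

Lemma urysohn_point (A : set G) (x : G) : closed A -> ~ A x ->
  exists s : G -> R, [/\ continuous s, forall y, 0 <= s y,
    forall y, A y -> s y = 0 & s x = 1].
Proof.
move=> cA Ax.
have sepAx : uniform_separator A [set x].
  apply: normal_uniform_separator => //.
  - exact: (compact_normal hausdorff_setT compact_setT).
  - exact/accessible_closed_set1/hausdorff_accessible/hausdorff_setT.
  - by rewrite -subset0 => y [Ay /= yx]; apply: Ax; rewrite -yx.
exists (Urysohn A [set x]); split.
- exact: Urysohn_continuous.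
- move=> y; have /(_ (imageT _ y)) :=
  @Urysohn_range G R A [set x] (Urysohn A [set x] y).
  by rewrite /= in_itv/= => /andP[].
- by move=> y Ay; apply: (@Urysohn_sub0 G R _ _ sepAx); exists y.
- by apply: (@Urysohn_sub1 G R _ _ sepAx); exists x.
Qed.

Lemma symmetric_bump (U : set G) : nbhs (1%g : G) U ->
  exists k : G -> R, [/\ continuous k, forall y, k y^-1%g = k y,
    forall y, 0 <= k y, 0 < k 1%g & forall y, ~ U y -> k y = 0].
Proof.
move=> nU; have [||s [cs s0 sU s1]] := @urysohn_point (~` U°) 1%g.
- exact/open_closedC/open_interior.
- by move=> h; apply: h; exact: nU.
exists (fun y => s y * s y^-1%g); split.
- by apply: continuous_mulf => //; exact: continuous_reflect.
- by move=> y; rewrite invgK mulrC.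
- by move=> y; rewrite mulr_ge0.
- by rewrite invg1 s1 mulr1.
- move=> y Uy; rewrite sU ?mul0r// => /interior_subset; exact: Uy.
Qed.

Lemma closed_image (H : compactGroupType) (i : H -> G) : continuous i ->
  closed (range i).
Proof.
move=> ci; apply: compact_closed; first exact: hausdorff_setT.
apply: continuous_compact; last exact: compact_setT.
exact: continuous_subspaceT.
Qed.

End Bumps.

Section InvariantFunctions.
Context {R : realType} {G : compactGroupType}.
Implicit Types (f u b : G -> R) (g x y : G).

Definition invariant (D : set G) f := forall g, D g -> forall y,
  f (g * y)%g = f y.

(** A Urysohn function that is 0 on the closed set [range i] and 1 at [x] is averaged over [H]: the
    result is 0 at the identity and positive at [x]. *)
Lemma separating_invariant (H : compactGroupType) (i : compactGroupHom H G) x :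
  ~ range i x -> exists f, [/\ continuous f,
    invariant (range i) f & f x <> f 1%g].
Proof.
move=> ix; have ci : continuous i by exact: cts_fun.
have [s [cs s0 si sx]] := @urysohn_point R _ _ _ (closed_image ci) ix.
pose F (p : G * H) := s (i p.2 * p.1)%g.
have cF : continuous F.
  apply: (continuous_compose cs); apply: continuous_mulg.
    exact/(continuous_compose ci)/snd_continuous.
  exact: fst_continuous.
exists (fun y => mean (fun h => F (y, h))); split.
- exact: continuous_mean.
- move=> _ [h _ <-] y.
  rewrite -[RHS](mean_rtranslate h); last exact: continuous_section.
  by congr mean; apply/funext => h'; rewrite /F/= gmulfM mulgA.
- apply/eqP; rewrite gt_eqF//.
  have -> : mean (fun h => F (1%g, h)) = 0.
    rewrite -[RHS](@mean_cst R H); congr mean; apply/funext => h.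
    by rewrite /F/= mulg1 si//; exists h.
  apply: (@mean_gt0 _ _ _ 1%g) => [|y|]; first exact: continuous_section.
    exact: s0.
  by rewrite /F/= gmulf1 mul1g sx.
Qed.

Lemma unif_adherent_ip (Y : set (G -> R)) u b c : continuous u ->
  (forall f, Y f -> continuous f /\ ip f u = c) -> unif_adherent Y b ->
  ip b u = c.
Proof.
move=> cu Yu Yb.
have cb : continuous b by apply: unif_adherent_continuous Yb => f /Yu[].
have [M uM] := continuous_bounded cu.
have M0 : 0 <= M by exact: le_trans (uM 1%g).
apply/eqP; rewrite -subr_eq0 -normr_le0.
apply: (@lel_addgt0 _ _ _ (M + 1)) => [|e e0]; first by rewrite ltr_wpDl.
have [f /Yu[cf <-] fb] := Yb e e0.
rewrite add0r distrC mean_dist//; try by cts.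
move=> y; rewrite -mulrBl normrM mulrC.
by rewrite ler_pM// (le_trans (uM y))// lerDl.
Qed.

Lemma unif_adherent_le (Y : set (G -> R)) b (c : R) x y :
  (forall f, Y f -> `|f x - f y| <= c) -> unif_adherent Y b ->
  `|b x - b y| <= c.
Proof.
move=> Yc Yb; apply: (@lel_addgt0 _ _ _ 2) => // e e0.
have [f /Yc fc fb] := Yb e e0; have := fb x; have := fb y; move: fc.
rewrite !ler_norml; lra.
Qed.

Lemma unif_adherent_norm (Y : set (G -> R)) b (c : R) :
  (forall f, Y f -> continuous f /\ ip f f <= c) -> unif_adherent Y b ->
  ip b b <= c.
Proof.
move=> Yc Yb.
have cb : continuous b by apply: unif_adherent_continuous Yb => f /Yc[].
have [M bM] := continuous_bounded cb.
have M0 : 0 <= M by exact: le_trans (bM 1%g).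
apply: (@lel_addgt0 _ _ _ (2 * M + 1)) => [|e e0]; first by lra.
have m1 : Num.min 1 e <= 1 by rewrite ge_min lexx.
have me : Num.min 1 e <= e by rewrite ge_min lexx orbT.
have [|f /Yc[cf fc] fb] := Yb (Num.min 1 e); first by rewrite lt_min ltr01.
suff : ip b b - ip f f <= (2 * M + 1) * e by lra.
rewrite -meanB; try by cts.
apply: mean_le => [|y]; first by cts.
rewrite -!expr2 subr_sqr (le_trans (ler_norm _))// normrM mulrC.
have fby := fb y; rewrite ler_pM//; last by rewrite distrC (le_trans fby).
have -> : b y + f y = 2 * b y + (f y - b y) by ring.
rewrite (le_trans (ler_normD _ _))// normrM ger0_norm//.
by rewrite lerD ?ler_wpM2l// (le_trans fby).
Qed.

(* The element of minimal L2-norm in a compact convex set of functions that have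
   the same inner products as [f] against invariant functions. *)
Lemma invariant_projection (D : set G) f : continuous f ->
  exists z, [/\ continuous z, invariant D z &
    forall u, continuous u -> invariant D u -> ip f u = ip z u].
Proof.
move=> cf; have [c fc] := continuous_bounded cf.
(* [Q] stands in for the closed convex hull of the translates of [f] by [D]. The third clause bounds
   the oscillation of [b] by that of the left translates of [f]; it yields equicontinuity and
   survives left translation and convex combination. *)
pose Q b := [/\ continuous b, forall y, `|b y| <= c,
  forall y y' (e : R), (forall g, `|f (g * y)%g - f (g * y')%g| <= e) ->
    `|b y - b y'| <= e &
  forall u, continuous u -> invariant D u -> ip b u = ip f u].
have Qf : Q f.
  by split=> // y y' e /(_ 1%g); rewrite !mul1g.
have c0 : 0 <= c by exact: le_trans (fc 1%g).
pose A := [set ip b b | b in Q].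
have Ainf : has_inf A.
  split; first by exists (ip f f), f.
  by exists 0 => _ [b [cb _ _ _] <-]; exact: ip_ge0.
pose P (e : R) := [set b | Q b /\ ip b b <= inf A + e].
pose F := filter_from [set e : R | 0 < e] P.
have FF : ProperFilter F.
  apply: filter_from_proper.
    apply: filter_from_filter; first by exists 1 => /=.
    move=> e1 e2 /= e10 e20; exists (Num.min e1 e2) => /=.
      by rewrite lt_min e10.
    move=> b [Qb be].
    by split; split=> //; apply: le_trans be _;
      rewrite lerD2l ge_min lexx ?orbT.
  move=> e /= e0; have [_ [b Qb <-] be] := inf_adherent e0 Ainf.
  by exists b; split=> //; exact: ltW.
have [|||z zP] := @equicontinuous_cluster R G F Q c FF.
- by exists 1; [exact: ltr01|move=> b []].
- by move=> b x [_ bc _ _]; exact: bc.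
- move=> e e0; have cfm : continuous (fun p : G * G => f (p.2 * p.1)%g).
    apply: (continuous_compose cf).
    by apply: continuous_mulg; [exact: snd_continuous|exact: fst_continuous].
  have := near_uniformly (1%g : G) cfm e0;
    apply: filterS => u fu b [_ _ bm _] x.
  by apply: bm => g; have := fu (g * x)%g; rewrite /= mulg1 mulgA.
have {}zP (e : R) : 0 < e -> unif_adherent (P e) z.
  move=> e0 d d0; have [|b [Pb _] bz] := zP (P e) _ d d0; last by exists b.
  by exists e.
have z1 := zP _ ltr01.
have cz : continuous z by apply: unif_adherent_continuous z1 => b [[]].
have Qz : Q z.
  split=> //.
  - move=> y; apply: (@lel_addgt0 _ _ _ 1) => // e e0; rewrite mul1r.
    have [b [[_ bc _ _] _] bz] := z1 e e0; have := bc y; have := bz y.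
    rewrite !ler_norml; lra.
  - move=> y y' e ye; apply: unif_adherent_le z1 => b [[_ _ bm _] _].
    exact: bm.
  - move=> u cu uD; apply: unif_adherent_ip z1 => // b [[cb _ _ bu] _].
    by split=> //; exact: bu.
have zmin : ip z z <= inf A.
  apply: (@lel_addgt0 _ _ _ 1) => // e e0; rewrite mul1r.
  by apply: unif_adherent_norm (zP e e0) => b [[cb _ _ _] be].
exists z; split=> //; last by move=> u cu uD; case: Qz => _ _ _ ->.
(* The midpoint [m] of [z] and its translate lies in [Q]. By the parallelogram identity its squared
   norm is that of [z] minus a quarter of [ip d d], so minimality forces [d = 0]. *)
move=> g Dg; pose z' y := z (g * y)%g.
have cz' : continuous z' by exact: continuous_ltranslate.
have nz' : ip z' z' = ip z z by exact: ip_ltranslate.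
pose m y := 2^-1 * z y + 2^-1 * z' y.
have Qm : Q m.
  case: Qz => _ zc zm zu; split.
  - by apply: continuous_addf; exact: continuous_scalef.
  - by move=> y; have := zc y; have := zc (g * y)%g;
    rewrite /m /z' !ler_norml; lra.
  - move=> y y' e ye; have := zm y y' e ye.
    have := zm (g * y)%g (g * y')%g e (fun h => ltac:(by rewrite !mulgA)).
    by rewrite /m /z' !ler_norml; lra.
  - move=> u cu uD; rewrite /m ip_linear//; last exact: continuous_scalef.
    have -> : ip (fun y => 2^-1 * z y) u = 2^-1 * ip f u.
      rewrite -(zu u cu uD) -meanZ; last by cts.
      by congr mean; apply/funext => y; rewrite mulrA.
    have -> : ip z' u = ip f u.
      rewrite -(zu u cu uD) -[RHS](ip_ltranslate g)//; congr mean.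
      by apply/funext => y; rewrite uD.
    lra.
have : inf A <= ip m m by apply: ge_inf; [case: Ainf|exists m].
have mE : m = (fun y => 2^-1 * z y + 2^-1 * z' y) by [].
pose d y := z y + (-1) * z' y.
have cd : continuous d by apply: continuous_addf => //;
  exact: continuous_scalef.
have -> : ip m m = ip z z - 4^-1 * ip d d.
  have -> : m = (fun y => z y + (- 2^-1) * d y).
    by apply/funext => y; rewrite /m /d; field.
  rewrite ip_sqrD// {1 3 4}/d ip_sqrD// ipC /d ip_linear// nz' (ipC z');
    by field.
move=> dle; have d0 : ip d d = 0.
  by apply/eqP; rewrite eq_le ip_ge0// andbT; lra.
move=> y; have := congr1 (@^~ y) (ip_eq0 cd d0).
by rewrite /d /z' /=; lra.
Qed.

End InvariantFunctions.

Section SeparatingEigenvector.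
Context {R : realType} {G H : compactGroupType}.
Variables (i : compactGroupHom H G) (x : G).
Hypothesis ix : ~ range i x.
Implicit Types f : G -> R.

Local Notation fixed f := (invariant (range i `|` [set x]) f).

(* An eigenvector among these functions cannot be fixed by [x], since it would
   then be orthogonal to itself. *)
Let mixed f := [/\ continuous f, invariant (range i) f &
  forall u : G -> R, continuous u -> fixed u -> ip f u = 0].

Let mixed_linear f (u : G -> R) (a : R) : mixed f -> mixed u ->
  mixed (fun y => f y + a * u y).
Proof.
move=> [cf jf of_] [cu ju ou]; split.
- by apply: continuous_addf => //; exact: continuous_scalef.
- by move=> g ig y; rewrite jf// ju.
- by move=> w cw fw; rewrite ip_linear// of_// ou// mulr0 addr0.
Qed.

Let conv_invariant k D f : continuous k -> continuous f -> invariant D f ->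
  invariant D (conv k f).
Proof.
move=> ck cf Df g Dg y.
have <- : conv k (fun y => f (g * y)%g) y = conv k f (g * y)%g.
  by rewrite conv_ltranslate.
by congr (conv k _ y); apply/funext => z; rewrite Df.
Qed.

Let mixed_conv k f : continuous k -> (forall y, k y^-1%g = k y) ->
  mixed f -> mixed (conv k f).
Proof.
move=> ck ks [cf jf of_]; split; first exact: continuous_conv.
  exact: conv_invariant.
move=> u cu fu; rewrite conv_sym// of_//; first exact: continuous_conv.
exact: conv_invariant.
Qed.

Let mixed_closed f : unif_adherent mixed f -> mixed f.
Proof.
move=> mf; split.
- by apply: unif_adherent_continuous mf => u [].
- move=> g ig y; apply/eqP; rewrite -subr_eq0 -normr_le0.
  apply: (@unif_adherent_le _ _ mixed f 0 (g * y)%g y _ mf) => u [_ ju _].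
  by rewrite ju// subrr normr0.
- move=> u cu fu; apply: unif_adherent_ip mf => // w [cw _ ow].
  by split=> //; exact: ow.
Qed.

(** The function is a separating one minus its projection. Were the difference zero, the separating
    function would be fixed by [x] and agree at [x] and 1. *)
Let mixed_nonzero : exists2 f, mixed f & f <> (fun=> 0).
Proof.
have [f [cf jf fx]] := @separating_invariant R _ _ _ _ ix.
have [z [cz fz zP]] := invariant_projection (range i `|` [set x]) cf.
exists (fun y => f y + (-1) * z y).
  split.
  - by apply: continuous_addf => //; exact: continuous_scalef.
  - by move=> g ig y; rewrite jf// fz//; left.
  - by move=> u cu fu; rewrite ip_linear// (zP u)// mulN1r subrr.
move=> f0; apply: fx; have fz' y : f y = z y.
  by have := congr1 (@^~ y) f0 => /= /eqP; rewrite mulN1r subr_eq0 => /eqP.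
by rewrite !fz' -[x]mulg1 fz//; right.
Qed.

(** To keep the operator from killing [f], the kernel vanishes wherever [f (p * u)] and [f p] have
    opposite signs; then [f p * conv k f p] is the mean of a nonnegative function that is positive
    at 1. *)
Let mixed_eigenvector : exists k v (lam : R),
  [/\ continuous k, forall y, k y^-1%g = k y, mixed v, v <> (fun=> 0) &
    lam != 0 /\ conv k v = fun y => lam * v y].
Proof.
have [f mf f0] := mixed_nonzero; have [cf jf of_] := mf.
have [p fp] : exists p, f p != 0.
  apply: contrapT => nf; apply: f0; apply/funext => p;
    apply/eqP/negPn/negP => fp.
  by apply: nf; exists p.
have f2 : 0 < f p ^+ 2 by rewrite exprn_even_gt0//= fp.
pose U := [set u | 0 <= f (p * u)%g * f p].
have [|k [ck ks k0 k1 kU]] := @symmetric_bump R G U.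
  have : continuous (fun u => f (p * u)%g * f p).
    by apply: continuous_mulf;
      [exact: continuous_ltranslate|exact: continuous_cstf].
  move=> /(_ 1%g)/cvgrPdist_le/(_ _ f2); apply: filterS => u /=.
  by rewrite /U/= mulg1 -expr2 ler_distlC subrr => /andP[].
have Tf : conv k f <> (fun=> 0).
  move=> Tf0; have : 0 < mean (fun u => k u * (f (p * u)%g * f p)).
    apply: (@mean_gt0 _ _ _ 1%g).
    - apply: continuous_mulf => //; apply: continuous_mulf;
      last exact: continuous_cstf.
      exact: continuous_ltranslate.
    - move=> u; have [Uu|Uu] := pselect (U u); first by rewrite mulr_ge0.
      by rewrite kU ?mul0r.
    - by rewrite mulg1 -expr2 mulr_gt0.
  suff -> : mean (fun u => k u * (f (p * u)%g * f p)) = f p * conv k f p.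
    by rewrite Tf0 mulr0 ltxx.
  have ci := continuous_section (x := p) (continuous_integrand ck cf).
  rewrite /conv -meanZ -1?[RHS](mean_ltranslate p)//;
    last by apply: continuous_scalef.
  by congr mean; apply/funext => u; rewrite mulKg; ring.
have [v [lam [mv lam0 v0 vE]]] := @eigenvector_exists R G k ck ks mixed
  (fun _ => ltac:(by case)) mixed_linear (fun _ =>
    mixed_conv ck ks) mixed_closed
  _ mf Tf.
by exists k, v, lam.
Qed.

(** Orthogonality to constants gives [v] mean zero, so adding a constant to the kernel does not
    change its image of [v]. The constant [lam - mean k] turns the function 1 into an eigenfunction
    for [lam] as well; then [v + 1] has mean 1 and is moved by [x] just as [v] is. *)
Lemma separating_eigenvector : exists k e (lam : R),
  [/\ continuous k, forall y, k y^-1%g = k y, lam != 0,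
    continuous e & conv k e = fun y => lam * e y] /\
  [/\ ip e e = 1, mean e != 0, invariant (range i) e & ~ invariant [set x] e].
Proof.
have [k [v [lam [ck ks [cv jv ov] v0 [lam0 vE]]]]] := mixed_eigenvector.
have c1 : continuous (fun _ : G => 1 : R) by exact: continuous_cstf.
have mv : mean v = 0.
  rewrite -[RHS](ov (fun=> 1))//.
  by congr mean; apply/funext => y; rewrite mulr1.
have xv : ~ invariant [set x] v.
  move=> xv; apply/v0/(ip_eq0 cv)/ov => // g [ig|xg] y; first exact: jv.
  exact: xv.
pose k' y := k y + (lam - mean k).
(* Written [1 * 1] to match the shape [f x + a * g x] of [conv_linear], with a constant [g]. *)
pose w y := v y + 1 * 1.
have ck' : continuous k' by apply: continuous_addf => //;
  exact: continuous_cstf.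
have cw : continuous w by apply: continuous_addf => //; exact: continuous_cstf.
have mw : mean w = 1.
  by rewrite meanD// ?mv ?mean_cst ?add0r ?mulr1//; exact: continuous_cstf.
have ww : 0 < ip w w.
  apply: ip_gt0 => // w0; move: mw; rewrite w0 mean_cst => /eqP.
  by rewrite eq_sym oner_eq0.
have Tw : conv k' w = fun y => lam * w y.
  have convk' (u : G -> R) y : continuous u ->
      conv k' u y = conv k u y + (lam - mean k) * mean u.
    move=> cu; rewrite /conv -meanZ// -meanD//; last exact: continuous_scalef.
      by congr mean; apply/funext => z; rewrite mulrDl.
    exact: (continuous_section (x := y) (continuous_integrand ck cu)).
  apply/funext => y; rewrite convk'// mw /w conv_linear// vE.
  have -> : conv k (fun=> 1) y = mean k.
    rewrite /conv -[RHS](mean_ltranslate y^-1)//.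
    by congr mean; apply/funext => z; rewrite mulr1.
  ring.
set s := (Num.sqrt (ip w w))^-1.
have s0 : s != 0 by rewrite invr_eq0 gt_eqF// sqrtr_gt0.
have s2 : s ^+ 2 = (ip w w)^-1 by rewrite exprVn sqr_sqrtr// ltW.
exists k', (fun y => s * w y), lam; split; split=> //.
- by move=> y; rewrite /k' ks.
- exact: continuous_scalef.
- have := conv_linear ck' s (@continuous_cstf R G 0) cw.
  under eq_fun do rewrite add0r; move=> ->; rewrite conv0 Tw.
  by apply/funext => y; ring.
- rewrite /ip; have -> : (fun y => s * w y * (s * w y)) = fun y =>
  s ^+ 2 * (w y * w y).
    by apply/funext => y; ring.
  rewrite meanZ; last by cts.
  by rewrite s2 mulVf// gt_eqF.
- by rewrite meanZ// mw mulr1.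
- by move=> g ig y; rewrite /w jv.
- move=> xw; apply: xv => g gx y; have := xw g gx y.
  by move/(mulfI s0)/addIr.
Qed.

End SeparatingEigenvector.

(** * Isometry groups *)

Lemma continuous_prod_topology (X : topologicalType) (I : eqType)
    (K : I -> topologicalType) (f : X -> prod_topology K) :
  (forall i, continuous (fun x => f x i)) -> continuous f.
Proof.
move=> cf x; apply/cvg_sup => i.
exact: (@continuous_comp_initial _ _ _ _ (f : X -> initial_topology _) (cf i)).
Qed.

Lemma injective_hausdorff (X Y : topologicalType) (f : X -> Y) :
  continuous f -> injective f -> hausdorff_space Y -> hausdorff_space X.
Proof.
move=> cf fi hY p q pq; apply/fi/hY => A B nA nB.
have [z [Az Bz]] := pq _ _ (cf p A nA) (cf q B nB).
by exists (f z).
Qed.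

(* The parameter [cX] lets canonical structure inference find compactness. *)
Record isometry (R : realType) (X : metricType R) (cX : compact [set: X]) :=
  Isometry {
  isometry_fun :> X -> X;
  isometry_inv : X -> X;
  isometryK : cancel isometry_fun isometry_inv;
  isometryVK : cancel isometry_inv isometry_fun;
  isometry_dist : forall x y,
    mdist (isometry_fun x) (isometry_fun y) = mdist x y
}.

Section IsometryGroup.
Context {R : realType} {X : metricType R} (cX : compact [set: X]).
Local Notation K := (isometry cX).
Implicit Types u v w : K.

HB.instance Definition _ := gen_eqMixin K.
HB.instance Definition _ := gen_choiceMixin K.

Lemma isometryP u v : u =1 v -> u = v.
Proof.
case: u v => [f f' fK f'K fd] [g g' gK g'K gd] /= /funext fg; subst g.
have fg' : f' = g'.
  by apply/funext => x; rewrite -[x in LHS]g'K fK.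
by subst g'; congr Isometry; exact: Prop_irrelevance.
Qed.

Lemma isometry_inv_dist u x y :
  mdist (isometry_inv u x) (isometry_inv u y) = mdist x y.
Proof. by rewrite -(isometry_dist u) !isometryVK. Qed.

Definition isometry_one : K :=
  @Isometry _ _ cX id id (fun=> erefl) (fun=> erefl) (fun _ _ => erefl).

Definition isometry_mul u v : K.
Proof.
apply: (@Isometry _ _ cX (fun x => u (v x))
  (fun x => isometry_inv v (isometry_inv u x))).
- by move=> x; rewrite !isometryK.
- by move=> x; rewrite !isometryVK.
- by move=> x y; rewrite !isometry_dist.
Defined.

Definition isometry_invg u : K :=
  @Isometry _ _ cX (isometry_inv u) u (isometryVK u) (isometryK u)
    (isometry_inv_dist u).

Let mulA : associative isometry_mul. Proof. by move=> u v w;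
  exact: isometryP. Qed.
Let mul1 : left_id isometry_one isometry_mul.
Proof. by move=> u; exact: isometryP. Qed.
Let mulr1' : right_id isometry_one isometry_mul.
Proof. by move=> u; exact: isometryP. Qed.
Let mulV : left_inverse isometry_one isometry_invg isometry_mul.
Proof. by move=> u; apply: isometryP => x /=; rewrite isometryK. Qed.
Let mulrV : right_inverse isometry_one isometry_invg isometry_mul.
Proof. by move=> u; apply: isometryP => x /=; rewrite isometryVK. Qed.

HB.instance Definition _ := isGroup.Build K mulA mul1 mulr1' mulV mulrV.

(** Recording the inverse beside the map makes inversion continuous, as a swap of the Boolean, and
    lets bijectivity survive pointwise limits. *)
Definition isometry_graph u : prod_topology (fun _ : bool * X => X) :=
  fun i => if i.1 then u i.2 else isometry_inv u i.2.

HB.instance Definition _ :=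
  Topological.copy K (initial_topology isometry_graph).

Lemma continuous_isometry_graph : continuous isometry_graph.
Proof. exact: initial_continuous. Qed.

Lemma continuous_isometry_eval x : continuous (fun u : K => u x).
Proof.
move=> u.
have c1 := @continuous_isometry_graph u.
have c2 := @proj_continuous (bool * X)%type (fun=> X) (true,
  x) (isometry_graph u).
exact: (cvg_comp _ _ c1 c2).
Qed.

Lemma continuous_isometry_inv_eval x : continuous (fun u : K =>
  isometry_inv u x).
Proof.
move=> u.
have c1 := @continuous_isometry_graph u.
have c2 := @proj_continuous (bool * X)%type (fun=> X) (false,
  x) (isometry_graph u).
exact: (cvg_comp _ _ c1 c2).
Qed.

Lemma continuous_isometry (Y : topologicalType) (f : Y -> K) :
  (forall x, continuous (fun y => f y x)) ->
  (forall x, continuous (fun y => isometry_inv (f y) x)) -> continuous f.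
Proof.
move=> cf cf'; apply: (@continuous_comp_initial K _ _ isometry_graph).
by apply: continuous_prod_topology => -[[] x]; [exact: cf|exact: cf'].
Qed.

(** Since every [a y] is an isometry, changing its argument costs no more than the change in [b];
    separate continuity thus becomes joint. *)
Let continuous_apply (Y : topologicalType) (a : Y -> X -> X) (b : Y -> X) :
  (forall y x x', mdist (a y x) (a y x') = mdist x x') ->
  (forall x, continuous (fun y => a y x)) -> continuous b ->
  continuous (fun y => a y (b y)).
Proof.
move=> ad ca cb y; apply/cvg_ballP => e e0; have e2 : 0 < e / 2 by lra.
have /cvg_ballP/(_ _ e2) h1 := cb y.
have /cvg_ballP/(_ _ e2) h2 := ca (b y) y.
apply: filterS2 h1 h2 => z bz az; rewrite [e]splitr; apply: ball_triangle az _.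
by move: bz; rewrite !ballEmdist/= ad.
Qed.

Let mulg_cts : continuous (fun p : K * K => (p.1 * p.2)%g).
Proof.
apply: continuous_isometry => x /=.
  apply: (@continuous_apply _ (fun p : K * K => p.1 : X -> X)).
  - by move=> p y z; exact: isometry_dist.
  - by move=> y; exact: (continuous_compose (@continuous_isometry_eval y)
    (@fst_continuous K K)).
  - exact: (continuous_compose (@continuous_isometry_eval x) (@snd_continuous K
    K)).
apply: (@continuous_apply _ (fun p : K * K => isometry_inv p.2)).
- by move=> p y z; exact: isometry_inv_dist.
- by move=> y; exact: (continuous_compose (@continuous_isometry_inv_eval y)
  (@snd_continuous K K)).
- exact: (continuous_compose (@continuous_isometry_inv_eval x) (@fst_continuous
  K K)).
Qed.

Let invg_cts : continuous (fun u : K => u^-1%g).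
Proof.
apply: continuous_isometry => x /=; first exact: continuous_isometry_inv_eval.
exact: continuous_isometry_eval.
Qed.

HB.instance Definition _ :=
  PreTopologicalGroup_isTopologicalGroup.Build K mulg_cts invg_cts.

Let mdist_le0 (x y : X) : (forall e : R, 0 < e -> mdist x y <= 2 * e) -> x = y.
Proof.
move=> h; apply/(@mdist_positivity R)/eqP; rewrite eq_le mdist_ge0 andbT.
by apply: (@lel_addgt0 _ _ _ 2) => // e e0; rewrite add0r h.
Qed.

(** Tychonoff gives a cluster point [p] of the graphs. At any finitely many indices one isometry
    approximates it, so [p] preserves distances and its two halves are mutually inverse: [p] is
    itself a graph. *)
Let compactK : compact [set: K].
Proof.
move=> F FF _.
have cP : compact ([set p | forall i, setT (p i)] :
  set (prod_topology (fun _ : bool * X => X))).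
  by apply: (@tychonoff (bool * X)%type (fun=> X) (fun=> setT)) => i.
have [|p [_ pF]] := cP (isometry_graph @ F); first exact: filterE.
have approx (s : seq (bool * X)) (e : R) : 0 < e ->
    exists u, forall i, i \in s -> mdist (p i) (isometry_graph u i) < e.
  move=> e0; have Fr : (isometry_graph @ F) (range isometry_graph).
    by apply: (@filterE _ F) => u; exists u.
  have [_ [[u _ <-] up]] := pF _ _ Fr (nbhs_pointwise p s e0).
  by exists u => i /up; rewrite ballEmdist.
have pK b : cancel (fun x => p (b, x)) (fun x => p (~~ b, x)).
  move=> x; apply: mdist_le0 => e e0.
  have [u us] := approx [:: (~~ b, p (b, x)); (b, x)] e e0.
  have h1 := us (~~ b, p (b, x)) (mem_head _ _).
  have h2 := us (b, x) (mem_last _ [:: _]).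
  rewrite (le_trans (metric_triangle _ (isometry_graph u (~~ b, p (b,
    x))) _))//.
  rewrite mulr2n mulrDl !mul1r lerD ?ltW//.
  apply: le_lt_trans h2; rewrite metric_sym.
  by case: (b); rewrite /isometry_graph/=;
    [rewrite -(isometry_dist u x) isometryVK|rewrite -(isometry_inv_dist u x)
      isometryK];
    rewrite metric_sym.
have pd x y : mdist (p (true, x)) (p (true, y)) = mdist x y.
  apply/eqP; rewrite -subr_eq0 -normr_le0.
  apply: (@lel_addgt0 _ _ _ 2) => // e e0; rewrite add0r.
  have [u us] := approx [:: (true, x); (true, y)] e e0.
  have := us _ (mem_head _ _); have := us (true, y) (mem_last _ [:: _]).
  rewrite /isometry_graph/= -(isometry_dist u x y).
  have := metric_triangle (p (true, x)) (u x) (p (true, y)).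
  have := metric_triangle (u x) (u y) (p (true, y)).
  have := metric_triangle (u x) (p (true, x)) (u y).
  have := metric_triangle (p (true, x)) (p (true, y)) (u y).
  by rewrite (metric_sym (u x) (p _)) (metric_sym (u y) (p _)) ler_norml; lra.
exists (@Isometry _ _ cX _ _ (pK true) (pK false) pd); split=> // A B FA.
move=> [C [[D oD <-] Dp] CB].
have FA' : (isometry_graph @ F) (isometry_graph @` A).
  by apply: (@filterS _ F _ A) => // u Au; exists u.
have nD : nbhs p D.
  apply: open_nbhs_nbhs; split=> //; move: Dp; congr D.
  by apply/funext => -[[] x].
have [_ [[u Au <-] Du]] := pF _ _ FA' nD.
by exists u; split=> //; exact: CB.
Qed.

Let hausdorffK : hausdorff_space K.
Proof.
apply: (injective_hausdorff continuous_isometry_graph).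
  move=> u v uv; apply: isometryP => x.
  exact: (congr1 (fun f : bool * X -> X => f (true, x)) uv).
apply: (@hausdorff_product (bool * X)%type (fun=> X)) => i.
exact: metric_hausdorff.
Qed.

HB.instance Definition _ :=
  Topological_isCompactHausdorff.Build K compactK hausdorffK.

End IsometryGroup.

(** * Equalizers from separating pairs *)

Lemma gmulf1_of_morph (G K : groupType) (f : G -> K) :
  {morph f : x y / (x * y)%g} -> f 1%g = 1%g.
Proof. by move=> fM; apply: (mulIg (f 1%g)); rewrite -fM !mul1g. Qed.

Definition compact_group_hom (G K : compactGroupType) (f : G -> K)
    (cf : continuous f) (fM : {morph f : x y / (x * y)%g}) :
      compactGroupHom G K :=
  HB.pack f (isContinuous.Build G K f cf)
    (isUMagmaMorphism.Build G K f (gmulf1_of_morph fM, fM)).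

Section GroupProduct.
Context {I : eqType} (K : I -> compactGroupType).

Definition group_product := prod_topology K.

HB.instance Definition _ := Topological.on group_product.

Let one : group_product := fun=> 1%g.
Let inv (a : group_product) : group_product := fun i => (a i)^-1%g.
Let mul (a b : group_product) : group_product := fun i => (a i * b i)%g.

Let mulA : associative mul.
Proof. by move=> a b c; apply: functional_extensionality_dep => i;
  exact: mulgA. Qed.
Let mul1 : left_id one mul.
Proof. by move=> a; apply: functional_extensionality_dep => i;
  exact: mul1g. Qed.
Let mulr1' : right_id one mul.
Proof. by move=> a; apply: functional_extensionality_dep => i;
  exact: mulg1. Qed.
Let mulV : left_inverse one inv mul.
Proof. by move=> a; apply: functional_extensionality_dep => i;
  exact: mulVg. Qed.
Let mulrV : right_inverse one inv mul.
Proof. by move=> a; apply: functional_extensionality_dep => i;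
  exact: mulgV. Qed.

HB.instance Definition _ :=
  isGroup.Build group_product mulA mul1 mulr1' mulV mulrV.

Let proj_cts i : continuous (fun a : group_product => a i).
Proof. exact: proj_continuous. Qed.

Let mulg_cts : continuous (fun p : group_product * group_product =>
  (p.1 * p.2)%g).
Proof.
apply: continuous_prod_topology => i; apply: continuous_mulg.
  exact: (continuous_compose (@proj_cts i) (@fst_continuous _ _)).
exact: (continuous_compose (@proj_cts i) (@snd_continuous _ _)).
Qed.

Let invg_cts : continuous (fun a : group_product => a^-1%g).
Proof.
by apply: continuous_prod_topology => i; apply: continuous_invg;
  exact: proj_cts.
Qed.

HB.instance Definition _ :=
  PreTopologicalGroup_isTopologicalGroup.Build group_product mulg_cts invg_cts.

Let compact_product : compact [set: group_product].
Proof.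
have := @tychonoff I K (fun=> setT) (fun i => @compact_setT (K i)).
by congr compact; apply/seteqP; split.
Qed.

Let hausdorff_group_product : hausdorff_space group_product.
Proof. by apply: hausdorff_product => i; exact: hausdorff_setT. Qed.

HB.instance Definition _ := Topological_isCompactHausdorff.Build group_product
  compact_product hausdorff_group_product.

End GroupProduct.

(** In the product over all points of [G] the two maps agree precisely on [range i], because the
    component at [x] tests [x] itself. A map equalizing them then factors through [i] pointwise. *)
Lemma is_equalizer_of_separation (G H : compactGroupType)
    (i : compactGroupHom H G) : injective i ->
  (forall x, ~ range i x -> exists (K : compactGroupType)
     (p q : compactGroupHom G K), (forall h,
       p (i h) = q (i h)) /\ p x <> q x) ->
  exists (K : compactGroupType) (p q : compactGroupHom G K), is_equalizer i p q.
Proof.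
move=> i_inj sep.
have {}sep x : exists (K : compactGroupType) (pq :
  compactGroupHom G K * compactGroupHom G K),
    (forall h, pq.1 (i h) = pq.2 (i h)) /\ (pq.1 x = pq.2 x -> range i x).
  have [ix|/sep[K [p [q [pqi pqx]]]]] := pselect (range i x).
    (* Points of the image receive a trivial pair, so that the family is indexed by all of [G]. *)
    by exists G, (idfun : compactGroupHom G G, idfun : compactGroupHom G G).
  by exists K, (p, q).
pose K x := sval (cid (sep x)).
pose p x := (sval (cid (svalP (cid (sep x))))).1 : compactGroupHom G (K x).
pose q x := (sval (cid (svalP (cid (sep x))))).2 : compactGroupHom G (K x).
have pqi x h : p x (i h) = q x (i h) by case: (svalP (cid (svalP (cid (sep
  x))))).
have pqx x : p x x = q x x ->
  range i x by case: (svalP (cid (svalP (cid (sep x))))).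
clearbody p q; clearbody K.
have hom (r : forall x, compactGroupHom G (K x)) :
    exists r' : compactGroupHom G (group_product K), forall y x, r' y x = r x y.
  have cr : continuous ((fun y => (fun x => r x y)) : G -> group_product K).
    by apply: continuous_prod_topology => x; exact: cts_fun.
  have mr : {morph ((fun y => (fun x => r x y)) : G -> group_product K) :
    a b / (a * b)%g}.
    by move=> a b; apply: functional_extensionality_dep => x; exact: gmulfM.
  by exists (compact_group_hom cr mr).
have [P PE] := hom p; have [Q QE] := hom q.
exists (group_product K), P, Q; split.
  apply/compactGroupHomP/funext => h; apply: functional_extensionality_dep => x.
  by rewrite /= PE QE pqi.
move=> L f /compactGroupHomP PQf.
have fi l : range i (f l).
  apply: pqx; rewrite -PE -QE.
  exact: (congr1 (fun g : L -> group_product K => g l (f l)) PQf).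
pose u l := sval (cid2 (fi l)).
have iu l : i (u l) = f l by rewrite /u; case: cid2.
have cu : continuous u.
  apply/continuous_closedP => C cC.
  (* Injectivity of [i] turns a preimage under [u] into one under [f]; the image of a closed set
     under [i] is compact, hence closed. *)
  have -> : u @^-1` C = f @^-1` (i @` C).
    apply/seteqP; split => l /=; first by exists (u l).
    by move=> [h Ch ih]; rewrite -(i_inj h (u l))// iu.
  apply: closed_comp; first by move=> l _; exact: cts_fun.
  apply: compact_closed; first exact: hausdorff_setT.
  apply: continuous_compact; first by apply: continuous_subspaceT;
    exact: cts_fun.
  exact: (subclosed_compact cC compact_setT (@subsetT _ C)).
have uM : {morph u : a b / (a * b)%g}.
  move=> a b; apply: i_inj; apply: (etrans (iu _)).
  have -> : f (a * b)%g = (f a * f b)%g by exact: gmulfM.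
  by rewrite -(iu a) -(iu b); exact/esym/gmulfM.
exists (compact_group_hom cu uM); split.
  by apply/compactGroupHomP/funext => l; exact: iu.
move=> v /compactGroupHomP iv; apply/compactGroupHomP/funext => l.
by apply: i_inj; rewrite /= iu -iv.
Qed.

(** * Reflections of eigenspaces *)

Record eigenball (R : realType) (G : compactGroupType) (k : G -> R) (lam : R) :=
  Eigenball {
    eigenball_fun :> G -> R;
    eigenball_continuous : continuous eigenball_fun;
    eigenballE : conv k eigenball_fun = fun x => lam * eigenball_fun x;
    eigenball_le1 : ip eigenball_fun eigenball_fun <= 1
  }.

Section EigenballMetric.
Context {R : realType} {G : compactGroupType} (k : G -> R) (lam : R).
Local Notation B := (eigenball k lam).
Implicit Types f g h : B.

HB.instance Definition _ := gen_eqMixin B.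
HB.instance Definition _ := gen_choiceMixin B.

Lemma eigenballP f g : f =1 g -> f = g.
Proof.
case: f g => [f cf fk f1] [g cg gk g1] /= /funext fg; subst g.
by congr Eigenball; exact: Prop_irrelevance.
Qed.

Let sub (f g : G -> R) := fun x => f x + (-1) * g x.

Let sub_continuous f g : continuous (sub f g).
Proof.
apply: continuous_addf; first exact: eigenball_continuous.
exact/continuous_scalef/eigenball_continuous.
Qed.

Definition l2dist (f g : G -> R) := Num.sqrt (ip (sub f g) (sub f g)).

Let l2distxx f : l2dist f f = 0.
Proof.
rewrite /l2dist; have -> : sub f f = fun=> 0.
  by apply/funext => x; rewrite /sub mulN1r subrr.
by rewrite ip0l sqrtr0.
Qed.

Let l2dist_eq0 f g : l2dist f g = 0 -> f = g.
Proof.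
move/eqP; rewrite sqrtr_eq0 => fg.
have : ip (sub f g) (sub f g) = 0 by apply/eqP; rewrite eq_le fg ip_ge0.
move/(ip_eq0 (@sub_continuous f g)) => e; apply: eigenballP => x.
by have := congr1 (@^~ x) e; rewrite /sub => /eqP;
  rewrite mulN1r subr_eq0 => /eqP.
Qed.

Let l2dist_sym f g : l2dist f g = l2dist g f.
Proof.
by congr (Num.sqrt (mean _)); apply/funext => x; rewrite /sub; ring.
Qed.

Let l2dist_triangle g f h : l2dist f h <= l2dist f g + l2dist g h.
Proof.
have cfg := @sub_continuous f g; have cgh := @sub_continuous g h.
rewrite -(@ler_pXn2r _ 2)// ?nnegrE ?addr_ge0 ?sqrtr_ge0//.
rewrite sqrrD !sqr_sqrtr ?ip_ge0//.
have -> : sub f h = fun x => sub f g x + 1 * sub g h x.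
  by apply/funext => x; rewrite /sub; ring.
rewrite ip_sqrD// expr1n mul1r mulr1 lerD2r lerD2l mulr_natl lerMn2r/=.
rewrite (le_trans (ler_norm _))// -sqrtr_sqr /l2dist -sqrtrM ?ip_ge0//.
by rewrite ler_wsqrtr// cauchy_schwarz.
Qed.

HB.instance Definition _ :=
  isMetric.Build R B l2distxx l2dist_eq0 l2dist_sym l2dist_triangle.

Lemma l2dist_le f g (e : R) : 0 <= e -> (forall x, `|f x - g x| <= e) ->
  mdist f g <= e.
Proof.
move=> e0 fg; rewrite -[leRHS]ger0_norm// -sqrtr_sqr ler_wsqrtr// ip_le// => x.
by rewrite /sub mulN1r.
Qed.

Lemma eigenball_isometry (u : B -> B) :
  (forall f g, ip (sub (u f) (u g)) (sub (u f) (u g)) = ip (sub f g) (sub f g))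
    ->
  forall f g, mdist (u f) (u g) = mdist f g.
Proof. by move=> h f g; congr Num.sqrt. Qed.

End EigenballMetric.

Section EigenballCompact.
Context {R : realType} {G : compactGroupType} (k : G -> R) (lam : R).
Local Notation B := (eigenball k lam).

Lemma unif_adherent_eigen (Y : set (G -> R)) b : continuous k ->
  (forall f, Y f -> continuous f /\ conv k f = fun x => lam * f x) ->
  unif_adherent Y b -> conv k b = fun x => lam * b x.
Proof.
move=> ck Yk Yb.
have cb : continuous b by apply: unif_adherent_continuous Yb => f /Yk[].
have [M kM] := continuous_bounded ck.
have M0 : 0 <= M by exact: le_trans (kM 1%g).
apply/funext => x; apply/eqP; rewrite -subr_eq0 -normr_le0.
apply: (@lel_addgt0 _ _ _ (M + `|lam| + 1)) => [|e e0].
  by rewrite ltr_wpDl// addr_ge0.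
rewrite add0r; have [f /Yk[cf fk] fb] := Yb e e0.
have -> : conv k b x - lam * b x = (conv k b x - conv k f x) + lam * (f x - b
  x).
  by rewrite fk; ring.
rewrite (le_trans (ler_normD _ _))//.
have : `|conv k b x - conv k f x| <= M * e.
  apply: mean_dist.
  - exact: (continuous_section (x := x) (continuous_integrand ck cb)).
  - exact: (continuous_section (x := x) (continuous_integrand ck cf)).
  - by move=> y; rewrite -mulrBr normrM ler_pM// distrC.
have : `|lam * (f x - b x)| <= `|lam| * e by rewrite normrM ler_wpM2l.
lra.
Qed.

(** An element of the ball is [lam^-1] times its convolution, so [conv_cluster] gives a uniform
    cluster point. Uniformity passes on continuity, the eigenvalue equation and the norm bound, and
    it dominates the L2 distance. *)
Lemma compact_eigenball : continuous k -> lam != 0 -> compact [set: B].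
Proof.
move=> ck lam0 F FF _.
have [|b' b'P] := @conv_cluster R G k ck ((fun f : B => conv k f) @ F) _.
  apply: (@filterE _ F) => f; exists f; split=> //.
    exact: eigenball_continuous.
  exact: eigenball_le1.
pose b x := lam^-1 * b' x.
have bP (A : set B) : F A -> unif_adherent [set (f : G -> R) | f in A] b.
  move=> FA e e0; have le0 : 0 < `|lam| * e by rewrite mulr_gt0// normr_gt0.
  have FA' : ((fun f : B => conv k f) @ F) [set conv k f | f in A].
    by apply: (@filterS _ F _ A) => // f Af; exists f.
  have [_ [f Af <-] fb] := b'P _ FA' _ le0; exists f; first by exists f.
  move=> x; rewrite -(ler_pM2l (x := `|lam|)) ?normr_gt0// -normrM.
  by have := fb x; rewrite eigenballE /b mulrBr mulrA divff// mul1r.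
have bT : unif_adherent [set (f : G -> R) | f in [set: B]] b.
  by apply: bP; exact: filterT.
have cb : continuous b.
  by apply: (unif_adherent_continuous _ bT) => _ [f _ <-];
    exact: eigenball_continuous.
have kb : conv k b = fun x => lam * b x.
  apply: unif_adherent_eigen bT => // _ [f _ <-].
  by split; [exact: eigenball_continuous|exact: eigenballE].
have b1 : ip b b <= 1.
  apply: unif_adherent_norm bT => _ [f _ <-].
  by split; [exact: eigenball_continuous|exact: eigenball_le1].
exists (Eigenball cb kb b1); split=> // A C FA /nbhs_ballP[e /= e0 eC].
have e2 : 0 < e / 2 by lra.
have [_ [f Af <-] fb] := bP A FA _ e2; exists f; split=> //; apply: eC.
rewrite ballEmdist/=; apply: (@le_lt_trans _ _ (e / 2)); last by lra.
by apply: l2dist_le; [exact: ltW|move=> x; rewrite distrC].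
Qed.

End EigenballCompact.

Section EigenballRepresentation.
Context {R : realType} {G : compactGroupType} (k : G -> R) (lam : R).
Hypotheses (ck : continuous k) (cB : compact [set: eigenball k lam]).
Local Notation B := (eigenball k lam).
Local Notation K := (isometry cB).

Let cts f : continuous (f : B) := eigenball_continuous (e := f).

Let translateE g (f : B) : conv k (fun y => f (g^-1 * y)%g) =
  fun y => lam * f (g^-1 * y)%g.
Proof. by rewrite conv_ltranslate// eigenballE. Qed.

Let translate_le1 g (f : B) :
  ip (fun y => f (g^-1 * y)%g) (fun y => f (g^-1 * y)%g) <= 1.
Proof. by rewrite ip_ltranslate// eigenball_le1. Qed.

Definition eigen_translate (g : G) (f : B) : B :=
  Eigenball (continuous_ltranslate (a := g^-1%g) (@cts f)) (translateE g f)
    (translate_le1 g f).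

Lemma eigen_translateE g f y : eigen_translate g f y = f (g^-1 * y)%g.
Proof. by []. Qed.

Lemma eigen_translateM g h f :
  eigen_translate (g * h)%g f = eigen_translate g (eigen_translate h f).
Proof. by apply: eigenballP => y; rewrite !eigen_translateE invgM mulgA. Qed.

Lemma eigen_translateK g : cancel (eigen_translate g) (eigen_translate g^-1%g).
Proof. by move=> f; apply: eigenballP => y;
  rewrite !eigen_translateE invgK mulKg. Qed.

Lemma eigen_translateVK g : cancel (eigen_translate g^-1%g) (eigen_translate g).
Proof. by move=> f; apply: eigenballP => y;
  rewrite !eigen_translateE invgK mulVKg. Qed.

Definition eigen_rep (g : G) : K.
Proof.
apply: (@Isometry _ _ cB _ _ (eigen_translateK g) (eigen_translateVK g)).
apply: eigenball_isometry => f f' /=.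
rewrite -[RHS](ip_ltranslate g^-1)//; cts;
  by [exact: eigenball_continuous|exact/continuous_scalef/eigenball_continuous].
Defined.

Lemma eigen_rep_morph : {morph eigen_rep : g h / (g * h)%g}.
Proof. by move=> g h; apply: isometryP => f; exact: eigen_translateM. Qed.

Let continuous_eigen_translate (f : B) :
  continuous (fun g : G => eigen_translate g f).
Proof.
have cf : continuous f by exact: eigenball_continuous.
move=> g; apply/cvg_ballP => e e0; have e2 : 0 < e / 2 by lra.
have cF : continuous (fun p : G * G => f (p.1^-1 * p.2)%g).
  exact: continuous_kernel.
have := near_uniformly g cF e2; apply: filterS => h hg.
rewrite ballEmdist/=; apply: (@le_lt_trans _ _ (e / 2)); last by lra.
by apply: l2dist_le; [exact: ltW|move=> x; rewrite distrC; exact: hg].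
Qed.

Lemma continuous_eigen_rep : continuous eigen_rep.
Proof.
apply: continuous_isometry => f /=; first exact: continuous_eigen_translate.
exact: (continuous_compose (@continuous_eigen_translate f) invg_continuous).
Qed.

Variable e : G -> R.
Hypotheses (ce : continuous e) (ke : conv k e = fun x => lam * e x).
Hypothesis e1 : ip e e = 1.

(** The Householder reflection in the hyperplane orthogonal to the unit vector [e]. *)
Definition reflect (f : G -> R) : G -> R := fun x => f x + (- 2 * ip f e) * e x.

Lemma continuous_reflection f : continuous f -> continuous (reflect f).
Proof. by move=> cf; apply: continuous_addf => //;
  exact: continuous_scalef. Qed.

Lemma ip_reflect f : continuous f -> ip (reflect f) (reflect f) = ip f f.
Proof. by move=> cf; rewrite ip_sqrD// e1; ring. Qed.

Lemma reflectK f : continuous f -> reflect (reflect f) = f.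
Proof.
move=> cf; apply/funext => x.
by rewrite /reflect ip_linear// e1; ring.
Qed.

Let reflect_eigen (f : B) : conv k (reflect f) = fun x => lam * reflect f x.
Proof.
by rewrite conv_linear// ke eigenballE; apply/funext => x; rewrite /reflect;
  ring.
Qed.

Let reflect_le1 (f : B) : ip (reflect f) (reflect f) <= 1.
Proof. by rewrite ip_reflect// eigenball_le1. Qed.

Definition eigen_reflect (f : B) : B :=
  Eigenball (continuous_reflection (@cts f)) (reflect_eigen f) (reflect_le1 f).

Lemma eigen_reflectE f : eigen_reflect f = reflect f :> (G -> R).
Proof. by []. Qed.

Lemma eigen_reflectK : involutive eigen_reflect.
Proof.
by move=> f; apply: eigenballP => x; rewrite !eigen_reflectE reflectK.
Qed.

Let eigen_reflect_dist f g :
  mdist (eigen_reflect f) (eigen_reflect g) = mdist f g.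
Proof.
apply: (@eigenball_isometry _ _ _ _ eigen_reflect) => {f g} f g.
rewrite -[RHS]ip_reflect; last by apply: continuous_addf => //;
  exact: continuous_scalef.
have -> // : (fun x => reflect f x + -1 * reflect g x) = reflect (fun x =>
  f x + -1 * g x).
by apply/funext => x; rewrite /reflect ip_linear//; ring.
Qed.

Definition eigen_reflection : K :=
  @Isometry _ _ cB _ _ eigen_reflectK eigen_reflectK eigen_reflect_dist.

Lemma conjugate_repE g f x :
  (eigen_reflection * eigen_rep g * eigen_reflection)%g f x =
  reflect (fun y => reflect f (g^-1 * y)%g) x.
Proof. by []. Qed.

Lemma eigen_repE g f x : eigen_rep g f x = f (g^-1 * x)%g.
Proof. by []. Qed.

(** When [g] fixes [e], invariance of the inner product shows that translation by [g] preserves the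
    component along [e], hence commutes with the reflection. *)
Lemma reflection_commute g : (forall y, e (g^-1 * y)%g = e y) ->
  (eigen_reflection * eigen_rep g * eigen_reflection)%g = eigen_rep g.
Proof.
move=> ge; apply: isometryP => f; apply: eigenballP => x.
rewrite conjugate_repE eigen_repE -[in RHS](reflectK (@cts f)) /reflect ge.
congr (_ + _ * _ * _).
rewrite -[RHS](ip_ltranslate g^-1)//; last exact: continuous_reflection.
by congr mean; apply/funext => y; rewrite ge.
Qed.

(* Evaluating the hypothesis at [e] shows that the translate of [e] is a multiple
   of [e]; the nonzero mean forces the factor to be 1. *)
Lemma reflection_detects g : mean e != 0 ->
  (eigen_reflection * eigen_rep g * eigen_reflection)%g = eigen_rep g ->
  forall y, e (g^-1 * y)%g = e y.
Proof.
move=> me cg; have e1' : ip e e <= 1 by rewrite e1.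
have cgE y : reflect (fun y => reflect e (g^-1 * y)%g) y = e (g^-1 * y)%g.
  exact: (congr1 (fun u : K => u (Eigenball ce ke e1') y) cg).
pose ge y := e (g^-1 * y)%g.
have cge : continuous ge by exact: continuous_ltranslate.
(* As [reflect e] is [- e], the hypothesis at [e] reads [- ge + 2 * ip ge e * e = ge]. *)
have geE y : ge y = ip ge e * e y.
  have := cgE y; have -> : (fun y => reflect e (g^-1 * y)%g) = (fun y =>
    (-1) * ge y).
    by apply/funext => z; rewrite /reflect e1 /ge; ring.
  have -> : reflect (fun y => -1 * ge y) y = - ge y + 2 * ip ge e * e y.
    have -> : (fun y => -1 * ge y) = (fun y => (fun=> 0) y + (-1) * ge y).
      by apply/funext => z; rewrite add0r.
    rewrite /reflect ip_linear//; last exact: continuous_cstf.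
    by rewrite ip0l; ring.
  by rewrite -/(ge y); lra.
have : mean ge = ip ge e * mean e.
  by rewrite -meanZ//; congr mean; apply/funext => y; rewrite geE.
rewrite /ge mean_ltranslate// -[LHS]mul1r => /(mulIf me) s1 y.
by rewrite -/(ge y) geE -s1 mul1r.
Qed.

End EigenballRepresentation.

Lemma separating_pair (R : realType) (G H : compactGroupType) (i :
  compactGroupHom H G) x :
  ~ range i x -> exists (K : compactGroupType) (p q : compactGroupHom G K),
    (forall h, p (i h) = q (i h)) /\ p x <> q x.
Proof.
move=> ix.
have [k [e [lam [[ck ks lam0 ce ke] [e1 me ie xe]]]]] :=
  @separating_eigenvector R _ _ i x ix.
have cB := compact_eigenball ck lam0.
pose p := compact_group_hom (@continuous_eigen_rep R G k lam ck cB)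
  (@eigen_rep_morph R G k lam ck cB).
pose c := eigen_reflection ck cB ce ke e1.
pose r g := (c * eigen_rep ck cB g * c)%g.
have cr : continuous r.
  apply: continuous_mulg; last by move=> g; exact: cvg_cst.
  apply: continuous_mulg; first by move=> g; exact: cvg_cst.
  exact: continuous_eigen_rep.
have cc : (c * c = 1)%g.
  by apply: isometryP => f; exact: eigen_reflectK.
have rM : {morph r : g h / (g * h)%g}.
  move=> g h; rewrite /r eigen_rep_morph !mulgA; congr (_ * _ * _)%g.
  by rewrite -[in RHS](mulgA _ c c) cc mulg1.
exists (isometry cB), p, (compact_group_hom cr rM); split.
  move=> h; apply/esym/reflection_commute => y.
  have ih : range i (i h) by exists h.
  by rewrite -[LHS](ie _ ih) mulVKg.
move=> /esym prx; apply: xe => _ -> y.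
by rewrite -[LHS](reflection_detects me prx) mulKg.
Qed.

Theorem theorem2p1 (G H : compactGroupType) (iota : compactGroupHom H G)
    (iota_inj : injective iota) :
  exists (K : compactGroupType) (phi0 phi1 : compactGroupHom G K),
    is_equalizer iota phi0 phi1.
Proof.
(* The statement mentions no real numbers, so a concrete [realType] is supplied here. *)
by apply: is_equalizer_of_separation => // x;
  exact: (@separating_pair Rdefinitions.R).
Qed.
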